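(* Consider the correlated Erdős–Rényi model with parameters $p=p_n$ and $s=s_n$. Assume that $p$ is bounded away from $1$ and $p=n^{-o(1)}$. Let $\epsilon>0$ be an arbitrarily small fixed constant. (i) If $nps^2\ge\frac{(2+\epsilon)\log n}{\log\frac1p-1+p}$, then for any constant $\delta<1$, $\mathbb{P}\{\mathrm{overlap}(\hat\pi_{\mathrm{ML}},\pi)\ge\delta\}=1-o(1)$. (ii) Conversely, if $nps^2\le\frac{(2-\epsilon)\log n}{\log\frac1p-1+p}$, then for any estimator $\hat\pi=\hat\pi(A,B)$ and any constant $\delta>0$, $\mathbb{P}\{\mathrm{overlap}(\hat\pi,\pi)\le\delta\}=1-o(1)$.
   Context: Let $\mathcal S_n$ be the set of permutations of $[n]=\{1,\dots,n\}$ and let the latent permutation $\pi$ be uniform on $\mathcal S_n$. The observations are two vectors $A=(A_{ij})_{1\le i<j\le n}$ and $B=(B_{ij})_{1\le i<j\le n}$ indexed by unordered pairs (so $A_{ij}=A_{ji}$, $B_{ij}=B_{ji}$) such that, conditionally on $\pi$, the pairs $(A_{\pi(i)\pi(j)},B_{ij})$, $1\le i<j\le n$, are i.i.d. with joint law $P$. In the correlated Erdős–Rényi model with parameters $(p,s)$, $p,s\in(0,1]$, set $q=ps$; $P$ is the joint law of two $\mathrm{Bern}(q)$ random variables $X,Y$ with $\mathbb{P}\{Y=1\mid X=1\}=s$. Equivalently, the graph with adjacency vector $(A_{\pi(i)\pi(j)})$ and the graph with adjacency vector $B$ are independently edge-subsampled with probability $s$ from a common parent graph $\mathcal G(n,p)$.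 Both $p$ and $s$ may depend on $n$. For $\pi'\in\mathcal S_n$ write $A^{\pi'}_{ij}=A_{\pi'(i)\pi'(j)}$ and $\langle A^{\pi'},B\rangle=\sum_{i<j}A_{\pi'(i)\pi'(j)}B_{ij}$. The maximum likelihood estimator is $\hat\pi_{\mathrm{ML}}\in\arg\max_{\pi'\in\mathcal S_n}\langle A^{\pi'},B\rangle$. For $\pi,\hat\pi\in\mathcal S_n$, $\mathrm{overlap}(\pi,\hat\pi)=\frac1n|\{i\in[n]:\pi(i)=\hat\pi(i)\}|$. An estimator is a function of $(A,B)$ with values in $\mathcal S_n$. Asymptotics are as $n\to\infty$; $\log$ is the natural logarithm. *)

(* Defs.v *)
From HB Require Import structures.
From mathcomp Require Import all_boot all_order all_algebra all_fingroup.
From mathcomp Require Import reals.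
From mathcomp Require Import ring lra.

Set Implicit Arguments.
Unset Strict Implicit.
Unset Printing Implicit Defensive.

Import Order.TTheory GRing.Theory Num.Theory.

Local Open Scope ring_scope.

(* Unordered pairs {i, j}, i != j, of vertices; [n] is represented by 'I_n.
   A sum or product over i < j is one over [upair n]. *)
Definition upair (n : nat) := {e : {set 'I_n} | #|e| == 2%N}.

Lemma perm_upair_subproof (n : nat) (sigma : 'S_n) (e : upair n) :
  #|sigma @: val e| == 2%N.
Proof. by rewrite card_imset ?(valP e) //; exact: perm_inj. Qed.

(* {i, j} |-> {sigma(i), sigma(j)} *)
Definition perm_upair (n : nat) (sigma : 'S_n) (e : upair n) : upair n :=
  Sub (sigma @: val e) (perm_upair_subproof sigma e).

Definition adjvec (n : nat) := {ffun upair n -> bool}.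

(* A^sigma_{ij} = A_{sigma(i) sigma(j)} *)
Definition relabel (n : nat) (sigma : 'S_n) (A : adjvec n) : adjvec n :=
  [ffun e => A (perm_upair sigma e)].

Definition inner (n : nat) (A B : adjvec n) : nat :=
  (\sum_(e : upair n) A e * B e)%N.

(* The law P of (X, Y), where X and Y are Bern(q), q = p s, and
   P{Y = 1 | X = 1} = s; these requirements force the four values below
   (see [edge_lawP]). *)
Definition edge_law (R : realType) (p s : R) (x y : bool) : R :=
  let q := p * s in
  match x, y with
  | true, true => q * s
  | true, false => q * (1 - s)
  | false, true => q * (1 - s)
  | false, false => 1 - 2 * q + q * s
  end.

Lemma edge_law_ge0 (R : realType) (p s : R) (x y : bool) :
  0 < p <= 1 -> 0 < s <= 1 -> 0 <= edge_law p s x y.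
Proof.
move=> /andP[p0 p1] /andP[s0 s1].
have s1' : 0 <= 1 - s by rewrite subr_ge0.
case: x y => -[] /=; try by rewrite !mulr_ge0 // ltW.
rewrite /edge_law.
have -> : 1 - 2 * (p * s) + p * s * s = (1 - p) + p * (1 - s) ^+ 2.
  by ring.
by rewrite addr_ge0 ?subr_ge0 // mulr_ge0 ?exprn_ge0 // ltW.
Qed.

Lemma edge_lawP (R : realType) (p s : R) (f : bool -> bool -> R) :
  0 < p <= 1 -> 0 < s <= 1 ->
  [/\ \sum_x \sum_y f x y = 1,
      \sum_y f true y = p * s,
      \sum_x f x true = p * s &
      f true true / (\sum_y f true y) = s] <->
  (forall x y, f x y = edge_law p s x y).
Proof.
move=> /andP[p0 _] /andP[s0 _]; have ps0 : p * s != 0 by rewrite mulf_neq0 ?gt_eqF.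
rewrite !big_bool /=; split=> [[h1 h2 h3]|h].
  rewrite h2 => /(congr1 ( *%R^~ (p * s))); rewrite /= divfK // => h4.
  have h5 : f true false = p * s - s * (p * s) by rewrite -h4 -h2; ring.
  have h6 : f false true = p * s - s * (p * s) by rewrite -h4 -h3; ring.
  have h7 : f false false = 1 - p * s - f false true by rewrite -h1 -h2; ring.
  by case=> -[]; rewrite /edge_law ?h7 ?h6 ?h5 ?h4; ring.
rewrite !h /edge_law; split; try ring.
have -> : p * s * s + p * s * (1 - s) = p * s by ring.
by rewrite mulrAC divff ?mul1r.
Qed.

Definition outcome (n : nat) : finType := ('S_n * adjvec n * adjvec n)%type.

(* Joint law of (pi, A, B): pi is uniform and, given pi, the pairs
   (A_{pi(i) pi(j)}, B_{ij}) are i.i.d. with law P. *)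
Definition er_law (R : realType) (n : nat) (p s : R) (w : outcome n) : R :=
  let: (pi, A, B) := w in
  (n`!)%:R^-1 * \prod_(e : upair n) edge_law p s (relabel pi A e) (B e).

Definition er_prob (R : realType) (n : nat) (p s : R) (E : pred (outcome n)) : R :=
  \sum_(w | E w) er_law p s w.

Lemma er_law_ge0 (R : realType) (n : nat) (p s : R) (w : outcome n) :
  0 < p <= 1 -> 0 < s <= 1 -> 0 <= er_law p s w.
Proof.
move=> hp hs; case: w => -[pi A] B; rewrite /er_law mulr_ge0 ?invr_ge0 ?ler0n //.
by apply: prodr_ge0 => e _; exact: edge_law_ge0.
Qed.

Lemma er_prob_total (R : realType) (n : nat) (p s : R) :
  er_prob p s (@predT (outcome n)) = 1.
Proof.
have perm_bij (sigma : 'S_n) : bijective (@perm_upair n sigma).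
  apply: injF_bij => e e' /(congr1 val) /= h; apply: val_inj.
  exact: (imset_inj (@perm_inj _ sigma) h).
have -> : er_prob p s (@predT (outcome n)) =
    \sum_(pi : 'S_n) \sum_(A : adjvec n) \sum_(B : adjvec n) er_law p s (pi, A, B).
  by rewrite /er_prob !pair_bigA /=; apply: eq_bigr => -[[]].
pose g x := \sum_y edge_law p s x y.
have hg : \sum_x g x = 1 by rewrite /g !big_bool /=; ring.
have h (pi : 'S_n) :
      \sum_(A : adjvec n) \sum_(B : adjvec n) er_law p s (pi, A, B) = (n`!)%:R^-1.
  have hA (A : adjvec n) : \sum_(B : adjvec n) er_law p s (pi, A, B) =
      (n`!)%:R^-1 * \prod_(e : upair n) g (A e).
    rewrite /er_law -big_distrr /=; congr (_ * _).
    rewrite [RHS](reindex (@perm_upair n pi)) /=; last exact: onW_bij.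
    rewrite /g (bigA_distr_bigA (fun e y => edge_law p s (A (perm_upair pi e)) y)) /=.
    by apply: eq_bigr => B _; apply: eq_bigr => e _; rewrite ffunE.
  under eq_bigr => A _ do rewrite hA.
  rewrite -big_distrr /= -(bigA_distr_bigA (fun (e : upair n) x => g x)) /=.
  by rewrite big1 ?mulr1 // => e _.
under eq_bigr => pi _ do rewrite h.
by rewrite sumr_const card_Sn -[LHS]mulr_natl divff // pnatr_eq0 -lt0n fact_gt0.
Qed.

Definition estimator (n : nat) := adjvec n -> adjvec n -> 'S_n.

(* Ties in the arg max are broken arbitrarily. *)
Definition is_ML (n : nat) (pihat : estimator n) : Prop :=
  forall (A B : adjvec n) (sigma : 'S_n),
    (inner (relabel sigma A) B <= inner (relabel (pihat A B) A) B)%N.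

Definition overlap (R : realType) (n : nat) (pi pi' : 'S_n) : R :=
  #|[set i : 'I_n | pi i == pi' i]|%:R / n%:R.

(* Main.v *)
Require Import Defs.
From HB Require Import structures.
From mathcomp Require Import classical_sets reals topology normedtype sequences exp.
From mathcomp Require Import all_boot all_order all_algebra all_fingroup.
From mathcomp Require Import ring lra zify.
Import Order.TTheory GRing.Theory Num.Theory.
Import numFieldNormedType.Exports.
Local Open Scope ring_scope.

Set Implicit Arguments.
Unset Strict Implicit.
Unset Printing Implicit Defensive.

(** Relabelling A by the latent permutation turns the model into a product
    model: the pairs (X_e, B_e), e ranging over unordered pairs of vertices, are
    i.i.d. with law P. A candidate permutation becomes sigma = pihat * pi^-1,
    whose fixed points are the vertices that are matched correctly. Write
    q = p s, L = ln (1/p), lambda = L - 1 + p; up to lower order terms p s^2 lambda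
    is the mutual information carried by one edge when s is small.

    Maximum likelihood. If sigma beats the truth, then on the set D of edges not
    contained in F = Fix(sigma) the sum of X_(sigma e) B_e is at least the sum of
    X_e B_e. Separating the two at a level slightly below the mean of the second
    sum leaves two events. The second sum is small: this depends on F alone, and
    a union over 2^n sets is cheap. The first sum is large: here one needs the
    exact exponential moment, because the union runs over about n^(n - |F|)
    permutations. Writing 1 + u X B as a sum over a hidden bit turns this moment
    into a product, along the cycles of sigma on edges, of one 2 x 2 kernel S. An
    inequality of Finner type (each hidden bit occurs in two factors, so
    Cauchy-Schwarz applies one bit at a time) bounds the product by
    ||S||_F^|D|, as if all cycles had length two ([mean_prod_permuted_le]); cycles
    of length one cost a factor sqrt 2 each, and there are at most n of them.
    With u = 1/p - 1 and |D| >= (n - |F|)(n - 1)/2 the exponent exceeds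
    (n - |F|) ln n once n p s^2 lambda exceeds 2 ln n by a constant factor; when
    s^2 is not small compared with p, a constant u is enough, because
    p = n^(-o(1)).

    Arbitrary estimators. For a set F of more than delta n vertices let Y be the
    posterior weight, relative to the law with A and B independent, of the
    permutations that agree with pihat(A, B) exactly on F. Its second moment is a
    sum over pairs pi, pi' that both agree with pihat, hence with each other, on
    F; so it is an average over sigma fixing F of expected likelihood ratios
    ([agreement_second_moment]). Few sigma fix F: their proportion is about
    1 / |F|!. Against this, edges within Fix(sigma) contribute their own
    likelihood ratio, which is truncated at n^((1 - eps/8)|Fix sigma|); the
    truncation is harmless even after a union over 2^n sets, by a Chernoff bound
    whose parameter is of order 1/(1 + L), where L = o(ln n). The
    other edges contribute only exp(n^2 s^4 / 4) = exp(O(n)), by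
    [mean_prod_permuted_le] again. The factor |F|! wins, and the sum of the
    square roots over all F tends to zero. *)

(** * Averages over a cube of products that share few coordinates *)

Definition flip (V : finType) (v : V) (x : {ffun V -> bool}) : {ffun V -> bool} :=
  [ffun w => x w (+) (w == v)].

Lemma flipK (V : finType) (v : V) : involutive (flip v).
Proof. by move=> x; apply/ffunP => w; rewrite !ffunE addbK. Qed.

Lemma flipC (V : finType) (v w : V) (x : {ffun V -> bool}) :
  flip v (flip w x) = flip w (flip v x).
Proof. by apply/ffunP => u; rewrite !ffunE addbAC. Qed.

Definition resample (R : realType) (V : finType) (v : V)
    (h : {ffun V -> bool} -> R) (x : {ffun V -> bool}) : R :=
  (h x + h (flip v x)) / 2.

Lemma sum_resample (R : realType) (V : finType) (v : V) (h : {ffun V -> bool} -> R) :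
  \sum_x resample v h x = \sum_x h x.
Proof.
have E : \sum_x h (flip v x) = \sum_x h x.
  by rewrite [RHS](reindex_inj (can_inj (flipK v))).
by rewrite -mulr_suml big_split /= E; field.
Qed.

(** Any two points of the cube are joined by flips of the coordinates in which
    they differ. *)
Lemma flip_invariant_const (T : Type) (V : finType) (h : {ffun V -> bool} -> T) :
  (forall v x, h (flip v x) = h x) -> forall x y, h x = h y.
Proof.
move=> hf x y; have [k] := ubnP #|[set v | x v != y v]|.
elim: k x => // k IH x hk.
have [/eqP|/set0Pn[v]] := eqVneq [set v | x v != y v] set0.
  move=> /eqP/setP e; congr h; apply/ffunP => v.
  by have := e v; rewrite !inE => /negbFE/eqP.
rewrite inE => xy; rewrite -(hf v x); apply: IH.
apply: leq_trans (_ : #|[set w | x w != y w]| <= k)%N; last by rewrite -ltnS.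
apply: proper_card; apply/properP; split.
  apply/subsetP => w; rewrite !inE ffunE; case: (eqVneq w v) => [-> //|_].
  by rewrite addbF.
exists v; first by rewrite inE.
by rewrite inE ffunE eqxx addbT negbK; move: xy; case: (x v); case: (y v).
Qed.

Lemma sqrt_mean_cauchy (R : realType) (a b c d : R) :
  0 <= a -> 0 <= b -> 0 <= c -> 0 <= d ->
  (Num.sqrt a * Num.sqrt c + Num.sqrt b * Num.sqrt d) / 2 <=
  Num.sqrt ((a + b) / 2) * Num.sqrt ((c + d) / 2).
Proof.
move=> a0 b0 c0 d0.
have h2 : (0 : R) <= 2^-1 by rewrite invr_ge0 ler0n.
have ab : 0 <= (a + b) / 2 by rewrite mulr_ge0 ?addr_ge0.
have cd : 0 <= (c + d) / 2 by rewrite mulr_ge0 ?addr_ge0.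
rewrite -ler_sqr ?nnegrE ?mulr_ge0 ?addr_ge0 ?mulr_ge0 ?sqrtr_ge0 //.
rewrite [X in _ <= X]exprMn !sqr_sqrtr //.
have := sqr_sqrtr a0; have := sqr_sqrtr b0; have := sqr_sqrtr c0; have := sqr_sqrtr d0.
move: (Num.sqrt a) (Num.sqrt b) (Num.sqrt c) (Num.sqrt d) => A B C D <- <- <- <-.
have -> : (A ^+ 2 + B ^+ 2) / 2 * ((C ^+ 2 + D ^+ 2) / 2) =
  ((A * C + B * D) / 2) ^+ 2 + ((A * D - B * C) / 2) ^+ 2 by field.
by rewrite lerDl sqr_ge0.
Qed.

(** Only two factors vary between [a] and [b], so this is the Cauchy-Schwarz
    inequality in two terms; for [j1 = j2] it is the concavity of the square root. *)
Lemma prod_sqrt_mean (R : realType) (J : finType) (a b : J -> R) (j1 j2 : J) :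
  (forall j, 0 <= a j) -> (forall j, 0 <= b j) ->
  (forall j, j != j1 -> j != j2 -> a j = b j) ->
  (\prod_j Num.sqrt (a j) + \prod_j Num.sqrt (b j)) / 2 <=
  \prod_j Num.sqrt ((a j + b j) / 2).
Proof.
move=> a0 b0 hab.
have E (j : J) : a j = b j -> (a j + b j) / 2 = b j by move=> ->; field.
rewrite !(bigD1 j1 (P := predT)) //=.
have [e|n12] := eqVneq j1 j2.
  have -> : \prod_(i | i != j1) Num.sqrt (a i) = \prod_(i | i != j1) Num.sqrt (b i).
    by apply: eq_bigr => i i1; rewrite hab // -e.
  have -> : \prod_(i | i != j1) Num.sqrt ((a i + b i) / 2) =
            \prod_(i | i != j1) Num.sqrt (b i).
    by apply: eq_bigr => i i1; rewrite E // hab // -e.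
  rewrite -mulrDl mulrAC ler_wpM2r ?prodr_ge0 // => [i _|]; first exact: sqrtr_ge0.
  have := @sqrt_mean_cauchy R (a j1) (b j1) 1 1 (a0 _) (b0 _) ler01 ler01.
  have -> : (1 + 1) / 2 = 1 :> R by field.
  by rewrite sqrtr1 !mulr1.
have P2 : j2 != j1 by rewrite eq_sym.
rewrite !(bigD1 j2 (P := fun i => i != j1)) //=.
have -> : \prod_(i | (i != j1) && (i != j2)) Num.sqrt (a i) =
          \prod_(i | (i != j1) && (i != j2)) Num.sqrt (b i).
  by apply: eq_bigr => i /andP[i1 i2]; rewrite hab.
have -> : \prod_(i | (i != j1) && (i != j2)) Num.sqrt ((a i + b i) / 2) =
          \prod_(i | (i != j1) && (i != j2)) Num.sqrt (b i).
  by apply: eq_bigr => i /andP[i1 i2]; rewrite E // hab.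
rewrite !mulrA -mulrDl [X in X <= _]mulrAC ler_wpM2r ?prodr_ge0 // => [i _|]; first exact: sqrtr_ge0.
exact: sqrt_mean_cauchy.
Qed.

Lemma sum_prod_sqrt_resample (R : realType) (V J : finType) (v : V)
    (h : J -> {ffun V -> bool} -> R) (j1 j2 : J) :
  (forall j x, 0 <= h j x) ->
  (forall j x, j != j1 -> j != j2 -> h j (flip v x) = h j x) ->
  \sum_x \prod_j Num.sqrt (h j x) <= \sum_x \prod_j Num.sqrt (resample v (h j) x).
Proof.
move=> h0 hv; rewrite -(sum_resample v).
by apply: ler_sum => x _; apply: (@prod_sqrt_mean _ _ _ _ j1 j2) => // j n1 n2; rewrite hv.
Qed.

(** An inequality of Finner type: if each coordinate influences at most two of
    the functions, the average of the product of the functions sqrt h_j is at most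
    the product of their L2 norms. Coordinates are averaged out one at a time,
    under the square roots, and each step is one use of Cauchy-Schwarz; once all
    are averaged out, every h_j is replaced by its mean. *)
Lemma sum_prod_sqrt_le (R : realType) (V J : finType)
    (h : J -> {ffun V -> bool} -> R) :
  (forall j x, 0 <= h j x) ->
  (forall v, exists j1 j2, forall j x, j != j1 -> j != j2 -> h j (flip v x) = h j x) ->
  \sum_x \prod_j Num.sqrt (h j x) <=
  (2 ^ #|V|)%:R * \prod_j Num.sqrt ((\sum_x h j x) / (2 ^ #|V|)%:R).
Proof.
move=> h0 hv.
pose A (r : seq V) j := foldr (@resample R V) (h j) r.
have A0 r j x : 0 <= A r j x.
  elim: r x => [|v r IH] x //=.
  by rewrite mulr_ge0 ?invr_ge0 ?ler0n // addr_ge0 ?IH.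
have Ainv r v : exists j1 j2, forall j x, j != j1 -> j != j2 -> A r j (flip v x) = A r j x.
  have [j1 [j2 H]] := hv v; exists j1, j2 => j x n1 n2.
  elim: r x => [|w r IH] x /=; first exact: H.
  by rewrite /resample flipC !IH.
have Asum r j : \sum_x A r j x = \sum_x h j x.
  by elim: r => [//|w r IH] /=; rewrite sum_resample.
have Amem r v j x : v \in r -> A r j (flip v x) = A r j x.
  elim: r x => [//|w r IH] x; rewrite inE /= => /predU1P[->|vr].
    by rewrite /resample flipK addrC.
  by rewrite /resample flipC !IH.
have Ale r : \sum_x \prod_j Num.sqrt (h j x) <= \sum_x \prod_j Num.sqrt (A r j x).
  elim: r => [//|w r IH] /=; apply: le_trans IH _.
  have [j1 [j2 H]] := Ainv r w.
  exact: (sum_prod_sqrt_resample (j1 := j1) (j2 := j2)).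
have card2 : #|{ffun V -> bool}| = (2 ^ #|V|)%N by rewrite card_ffun card_bool.
have Ac j x : A (enum V) j x = (\sum_x h j x) / (2 ^ #|V|)%:R.
  have c : forall y, A (enum V) j y = A (enum V) j x.
    move=> y; apply: flip_invariant_const => v z; apply: Amem; exact: mem_enum.
  rewrite -(Asum (enum V)); under eq_bigr => y _ do rewrite c.
  by rewrite sumr_const card2 -(mulr_natr (A _ j x)) mulfK // pnatr_eq0 expn_eq0.
apply: le_trans (Ale (enum V)) _.
have -> : \sum_x \prod_j Num.sqrt (A (enum V) j x) =
  \sum_(x : {ffun V -> bool}) \prod_j Num.sqrt ((\sum_x h j x) / (2 ^ #|V|)%:R).
  by apply: eq_bigr => x _; apply: eq_bigr => j _; rewrite Ac.
by rewrite sumr_const card2 mulr_natl.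
Qed.

(** * Products of a pair of vectors coupled through a permutation *)

Lemma average_two_coordinates (R : realType) (V : finType) (u v : V) (f : bool -> bool -> R) :
  u != v ->
  (\sum_(x : {ffun V -> bool}) f (x u) (x v)) / (2 ^ #|V|)%:R =
  (\sum_a \sum_b f a b) / 4.
Proof.
move=> uv; rewrite -(sum_resample u) -(sum_resample v).
have E (x : {ffun V -> bool}) :
    resample v (resample u (fun x => f (x u) (x v))) x = (\sum_a \sum_b f a b) / 4.
  rewrite /resample !ffunE !eqxx (eq_sym v u) (negbTE uv) !addbF !addbT !big_bool /=.
  by case: (x u); case: (x v) => /=; field.
under eq_bigr => x _ do rewrite E.
rewrite sumr_const card_ffun card_bool -(mulr_natr ((\sum_a \sum_b f a b) / 4)) mulfK //.
by rewrite pnatr_eq0 expn_eq0.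
Qed.

Lemma average_one_coordinate (R : realType) (V : finType) (u : V) (f : bool -> R) :
  (\sum_(x : {ffun V -> bool}) f (x u)) / (2 ^ #|V|)%:R = (\sum_a f a) / 2.
Proof.
rewrite -(sum_resample u).
have E (x : {ffun V -> bool}) : resample u (fun x => f (x u)) x = (\sum_a f a) / 2.
  rewrite /resample !ffunE !eqxx !addbT !big_bool /=.
  by case: (x u) => /=; field.
under eq_bigr => x _ do rewrite E.
rewrite sumr_const card_ffun card_bool -(mulr_natr ((\sum_a f a) / 2)) mulfK //.
by rewrite pnatr_eq0 expn_eq0.
Qed.

(** For a probability [P], the expectation of [f X B] when the pairs (X_e, B_e) are
    i.i.d. with law [P]; in the model [X] is the vector A relabelled by the latent permutation. *)
Definition mean (R : realType) (V : finType) (P : bool -> bool -> R)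
    (f : {ffun V -> bool} -> {ffun V -> bool} -> R) : R :=
  \sum_(X : {ffun V -> bool}) \sum_(B : {ffun V -> bool}) (\prod_e P (X e) (B e)) * f X B.

Lemma eq_mean (R : realType) (V : finType) (P : bool -> bool -> R)
    (f g : {ffun V -> bool} -> {ffun V -> bool} -> R) :
  (forall X B, f X B = g X B) -> mean P f = mean P g.
Proof. by move=> h; apply: eq_bigr => X _; apply: eq_bigr => B _; rewrite h. Qed.

Lemma mean_sum (R : realType) (V I : finType) (Q : pred I) (P : bool -> bool -> R)
    (f : I -> {ffun V -> bool} -> {ffun V -> bool} -> R) :
  mean P (fun X B => \sum_(i | Q i) f i X B) = \sum_(i | Q i) mean P (f i).
Proof.
rewrite [RHS]exchange_big; apply: eq_bigr => X _; rewrite [RHS]exchange_big.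
by apply: eq_bigr => B _; rewrite mulr_sumr.
Qed.

Lemma meanD (R : realType) (V : finType) (P : bool -> bool -> R)
    (f g : {ffun V -> bool} -> {ffun V -> bool} -> R) :
  mean P (fun X B => f X B + g X B) = mean P f + mean P g.
Proof.
rewrite -big_split; apply: eq_bigr => X _ /=; rewrite -big_split.
by apply: eq_bigr => B _; rewrite mulrDr.
Qed.

Lemma meanZ (R : realType) (V : finType) (P : bool -> bool -> R) (c : R)
    (f : {ffun V -> bool} -> {ffun V -> bool} -> R) :
  mean P (fun X B => c * f X B) = c * mean P f.
Proof.
rewrite mulr_sumr; apply: eq_bigr => X _ /=; rewrite mulr_sumr.
by apply: eq_bigr => B _; rewrite mulrCA.
Qed.

Lemma ler_mean (R : realType) (V : finType) (P : bool -> bool -> R)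
    (f g : {ffun V -> bool} -> {ffun V -> bool} -> R) :
  (forall a b, 0 <= P a b) -> (forall X B, f X B <= g X B) -> mean P f <= mean P g.
Proof.
move=> P0 h; apply: ler_sum => X _; apply: ler_sum => B _.
by rewrite ler_wpM2l // prodr_ge0.
Qed.

Lemma mean_prod (R : realType) (V : finType) (P : bool -> bool -> R)
    (g : V -> bool -> bool -> R) :
  mean P (fun X B => \prod_e g e (X e) (B e)) =
  \prod_e \sum_a \sum_b P a b * g e a b.
Proof.
rewrite (bigA_distr_bigA (fun e a => \sum_b P a b * g e a b)) /=.
apply: eq_bigr => X _.
rewrite (bigA_distr_bigA (fun e b => P (X e) b * g e (X e) b)) /=.
by apply: eq_bigr => B _; rewrite big_split.
Qed.

(** The matrix of the moments E[phi(X)^c phi(Y)^d], c and d in {0, 1}, for (X, Y)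
    of law [P]. *)
Definition gram (R : realType) (P : bool -> bool -> R) (phi : bool -> R) (c d : bool) : R :=
  \sum_a \sum_b P a b * ((if c then phi a else 1) * (if d then phi b else 1)).

(** Each factor 1 + phi phi is a sum over a hidden bit c_e. Once X and B are
    summed out, what remains is a sum over c of a product of kernel entries
    gram (c_(tau^-1 e)) (c_e); the bit c_v enters only the factors of v and
    tau v, so [sum_prod_sqrt_le] applies. For a fixed e the two arguments of the
    kernel coincide and the L2 norm is taken over the diagonal, which is at most
    sqrt 2 times the norm over independent bits. *)
Lemma mean_prod_permuted_le (R : realType) (V : finType) (P : bool -> bool -> R)
    (phi : bool -> R) (tau : {perm V}) (E : {set V}) :
  \sum_a \sum_b P a b = 1 ->
  (forall e, (tau e \in E) = (e \in E)) ->
  mean P (fun X B => \prod_(e in E) (1 + phi (X (tau e)) * phi (B e))) <=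
  Num.sqrt (\sum_c \sum_d gram P phi c d ^+ 2) ^+ #|E| *
  Num.sqrt 2 ^+ #|[set e in E | tau e == e]|.
Proof.
move=> P1 tE.
set N := \sum_c _.
have tVE e : ((tau^-1)%g e \in E) = (e \in E) by rewrite -tE permKV.
pose al (e : V) (c a : bool) : R := if (e \in E) && c then phi a else 1.
(* Outside E the hidden bit is free; the weight 1/2 makes its sum equal to 1. *)
pose k (e : V) : R := if e \in E then 1 else 2^-1.
pose T (e : V) (c : {ffun V -> bool}) : R :=
  if e \in E then gram P phi (c ((tau^-1)%g e)) (c e) else 2^-1.
have expand (X B : {ffun V -> bool}) :
    \prod_(e in E) (1 + phi (X (tau e)) * phi (B e)) =
    \sum_(c : {ffun V -> bool}) \prod_e (k e *
      (al ((tau^-1)%g e) (c ((tau^-1)%g e)) (X e) * al e (c e) (B e))).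
  have -> : \prod_(e in E) (1 + phi (X (tau e)) * phi (B e)) =
    \prod_e \sum_(c : bool) (k e * (al e c (X (tau e)) * al e c (B e))).
    rewrite big_mkcond; apply: eq_bigr => e _; rewrite big_bool /k /al.
    by case: (e \in E) => /=; [ring | field].
  rewrite (bigA_distr_bigA (fun e c => k e * (al e c (X (tau e)) * al e c (B e)))) /=.
  apply: eq_bigr => c _; rewrite !big_split /=; congr (_ * (_ * _)).
  rewrite [RHS](reindex_inj (@perm_inj _ tau)) /=.
  by apply: eq_bigr => e _; rewrite permK.
have -> : mean P (fun X B => \prod_(e in E) (1 + phi (X (tau e)) * phi (B e))) =
    \sum_(c : {ffun V -> bool}) \prod_e T e c.
  rewrite (eq_mean _ expand) mean_sum; apply: eq_bigr => c _.
  rewrite (mean_prod _ (fun e a b => k e *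
      (al ((tau^-1)%g e) (c ((tau^-1)%g e)) a * al e (c e) b))).
  apply: eq_bigr => e _; rewrite /T /k /al tVE; case: ifP => eE /=.
    by rewrite /gram; apply: eq_bigr => a _; apply: eq_bigr => b _; rewrite mul1r.
  by rewrite !big_bool /=; move: P1; rewrite !big_bool /= => P1; nra.
have N0 : 0 <= N by rewrite sumr_ge0 // => c _; rewrite sumr_ge0 // => d _; rewrite sqr_ge0.
have := @sum_prod_sqrt_le R V V (fun e c => T e c ^+ 2) (fun e c => sqr_ge0 _).
have dep v : exists j1 j2, forall (j : V) (x : {ffun V -> bool}), j != j1 -> j != j2 ->
    T j (flip v x) ^+ 2 = T j x ^+ 2.
  exists v, (tau v) => j x jv jtv; rewrite /T !ffunE (negbTE jv) addbF.
  have -> : ((tau^-1)%g j == v) = false.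
    by apply/eqP => e; move: jtv; rewrite -e permKV eqxx.
  by rewrite addbF.
move=> /(_ dep) H.
apply: le_trans (_ : \sum_(c : {ffun V -> bool}) \prod_e Num.sqrt (T e c ^+ 2) <= _).
  apply: ler_sum => c _; apply: le_trans (ler_norm _) _.
  by rewrite normr_prod; apply: ler_prod => e _; rewrite normr_ge0 sqrtr_sqr lexx.
apply: le_trans H _.
pose w e : R := (if e \in E then Num.sqrt N else 1) *
                (if e \in [set e in E | tau e == e] then Num.sqrt 2 else 1).
have -> : Num.sqrt N ^+ #|E| * Num.sqrt 2 ^+ #|[set e in E | tau e == e]| = \prod_e w e.
  rewrite -!prodr_const [X in X * _]big_mkcond [X in _ * X]big_mkcond -big_split /=; by [].
have -> : \prod_e w e = (2 ^ #|V|)%:R * \prod_e (2^-1 * w e).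
  rewrite [in RHS]big_split /= prodr_const mulrA natrX exprVn mulfV ?mul1r //.
  by rewrite expf_neq0 // pnatr_eq0.
rewrite ler_wpM2l ?ler0n //; apply: ler_prod => e _; rewrite sqrtr_ge0 /=.
have half : Num.sqrt (2^-1 ^+ 2 : R) = 2^-1.
  by rewrite sqrtr_sqr ger0_norm // invr_ge0 ler0n.
rewrite /w /T inE; case: ifP => eE /=; last first.
  rewrite sumr_const card_ffun card_bool -(mulr_natr (2^-1 ^+ 2)) mulfK; last first.
    by rewrite pnatr_eq0 expn_eq0.
  by rewrite half !mulr1.
case: eqP => [fix_e|/eqP nfix].
  have -> : (tau^-1)%g e = e by rewrite -{1}fix_e permK.
  rewrite (average_one_coordinate e (fun c => gram P phi c c ^+ 2)).
  rewrite -{2}half -!sqrtrM ?sqr_ge0 //.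
  apply: ler_wsqrtr.
  have -> : 2^-1 ^+ 2 * (N * 2) = N / 2 by field.
  rewrite ler_wpM2r ?invr_ge0 ?ler0n // ler_sum // => c _.
  by rewrite (bigD1 c (P := predT)) //= lerDl sumr_ge0 // => d _; rewrite sqr_ge0.
rewrite (average_two_coordinates (u := (tau^-1)%g e) (v := e) (fun c d => gram P phi c d ^+ 2)).
  rewrite mulr1 -half -sqrtrM ?sqr_ge0 //; apply: ler_wsqrtr.
  by rewrite le_eqVlt; apply/orP; left; apply/eqP; rewrite -/N; field.
by apply: contra nfix => /eqP h; rewrite -{1}h permKV.
Qed.

(** * Edges, relabellings and exponential tail bounds *)

Lemma ler_nat_expR (R : realType) (x t y : R) :
  0 <= x -> (t <= y)%R%:R <= expR (- (x * t)) * expR (x * y).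
Proof.
move=> x0; rewrite -expRD; have [h|_] := leP t y; last by rewrite expR_ge0.
by rewrite -[leLHS]expR0 ler_expR addrC subr_ge0 ler_wpM2l.
Qed.

(** Markov's inequality for the exponential, which factorizes over the edges. *)
Lemma chernoff (R : realType) (V : finType) (P v : bool -> bool -> R) (D : {set V}) (t x : R) :
  (forall a b, 0 <= P a b) -> \sum_a \sum_b P a b = 1 -> 0 <= x ->
  mean P (fun X B => (t <= \sum_(e in D) v (X e) (B e))%R%:R) <=
  expR (- (x * t)) * (\sum_a \sum_b P a b * expR (x * v a b)) ^+ #|D|.
Proof.
move=> P0 P1 x0.
pose g (e : V) a b := if e \in D then expR (x * v a b) else 1.
apply: (@le_trans _ _ (mean P (fun X B => expR (- (x * t)) * \prod_e g e (X e) (B e)))).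
  apply: ler_mean => // X B; apply: le_trans (ler_nat_expR _ _ x0) _.
  rewrite ler_wpM2l ?expR_ge0 // mulr_sumr expR_sum -big_mkcond.
  exact: lexx.
rewrite meanZ ler_wpM2l ?expR_ge0 // mean_prod -prodr_const [leRHS]big_mkcond.
rewrite le_eqVlt; apply/orP; left; apply/eqP; apply: eq_bigr => e _.
rewrite /g; case: ifP => // _; rewrite -[RHS]P1.
by apply: eq_bigr => a _; apply: eq_bigr => b _; rewrite mulr1.
Qed.

Lemma perm_upair_inj (n : nat) (sigma : 'S_n) : injective (@perm_upair n sigma).
Proof.
move=> e e' /(congr1 val) /= h; apply: val_inj.
exact: (imset_inj (@perm_inj _ sigma) h).
Qed.

Definition edge_perm (n : nat) (sigma : 'S_n) : {perm upair n} := perm (@perm_upair_inj n sigma).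

Lemma perm_upairM (n : nat) (sigma tau : 'S_n) (e : upair n) :
  perm_upair (sigma * tau)%g e = perm_upair tau (perm_upair sigma e).
Proof.
apply: val_inj; rewrite /= -imset_comp; apply: eq_imset => i.
by rewrite /= permM.
Qed.

Lemma perm_upair1 (n : nat) (e : upair n) : perm_upair 1%g e = e.
Proof. by apply: val_inj; rewrite /= (eq_imset _ (@perm1 _)) imset_id. Qed.

Lemma relabelM (n : nat) (sigma tau : 'S_n) (A : adjvec n) :
  relabel sigma (relabel tau A) = relabel (sigma * tau)%g A.
Proof. by apply/ffunP => e; rewrite !ffunE perm_upairM. Qed.

Lemma relabel1 (n : nat) (A : adjvec n) : relabel 1%g A = A.
Proof. by apply/ffunP => e; rewrite !ffunE perm_upair1. Qed.

Lemma relabelK (n : nat) (sigma : 'S_n) : cancel (@relabel n sigma) (relabel sigma^-1%g).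
Proof. by move=> A; rewrite relabelM mulVg relabel1. Qed.

Lemma relabelVK (n : nat) (sigma : 'S_n) : cancel (@relabel n sigma^-1%g) (relabel sigma).
Proof. by move=> A; rewrite relabelM mulgV relabel1. Qed.

(** Given pi, the vector X = A^pi and B follow the product law; the event is
    rewritten in terms of X. *)
Lemma er_prob_mean (R : realType) (n : nat) (p s : R) (E : pred (outcome n)) :
  er_prob p s E = (n`!)%:R^-1 * \sum_(pi : 'S_n)
    mean (edge_law p s) (fun X B => (E (pi, relabel pi^-1%g X, B))%:R).
Proof.
rewrite /er_prob big_mkcond /=.
have -> : \sum_w (if E w then er_law p s w else 0) =
    \sum_(pi : 'S_n) \sum_(A : adjvec n) \sum_(B : adjvec n)
      (if E (pi, A, B) then er_law p s (pi, A, B) else 0).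
  by rewrite !pair_bigA /=; apply: eq_bigr => -[[]].
rewrite mulr_sumr; apply: eq_bigr => pi _.
rewrite (reindex_inj (can_inj (@relabelVK n pi))) /= mulr_sumr.
apply: eq_bigr => X _; rewrite mulr_sumr; apply: eq_bigr => B _.
by rewrite relabelVK; case: ifP => _; rewrite ?mulr1 ?mulr0.
Qed.

Lemma edge_law_total (R : realType) (p s : R) : \sum_a \sum_b edge_law p s a b = 1.
Proof. by rewrite !big_bool /=; ring. Qed.

(** For F = Fix(sigma) this contains every edge that sigma moves, but also the
    edges whose endpoints sigma swaps; keeping the latter makes the set depend on
    [F] only. *)
Definition not_within (n : nat) (F : {set 'I_n}) : {set upair n} :=
  [set e : upair n | ~~ (val e \subset F)].

Definition fixpoints (n : nat) (sigma : 'S_n) : {set 'I_n} := [set i | sigma i == i].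

Lemma card_within (n : nat) (F : {set 'I_n}) :
  #|~: not_within F| = 'C(#|F|, 2).
Proof.
rewrite -cards_draws -(card_imset _ val_inj); apply: eq_card => B.
rewrite inE; apply/imsetP/andP => [[e]|[BF B2]].
  by rewrite !inE negbK => eF ->; split=> //; exact: (valP e).
by exists (Sub B B2) => //; rewrite !inE negbK SubK.
Qed.

Lemma card_upair (n : nat) : #|{: upair n}| = 'C(n, 2).
Proof.
have := card_within [set: 'I_n]; rewrite cardsT card_ord => <-.
rewrite -cardsT; apply: eq_card => e; rewrite !inE negbK.
exact/esym/subsetT.
Qed.

Lemma card_not_within (n : nat) (F : {set 'I_n}) :
  ((n - #|F|) * n.-1 <= #|not_within F|.*2)%N.
Proof.
have := cardsC (not_within F); rewrite card_within card_upair.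
have fn : (#|F| <= n)%N by rewrite -[X in (_ <= X)%N]card_ord max_card.
move=> /(congr1 double); rewrite doubleD -!muln2  -!(mulnC 2).
have E m : (2 * 'C(m, 2) = m * m.-1)%N by rewrite bin2 mul2n halfK oddM; case: m => //= m; rewrite andNb subn0.
rewrite !E => H.
have {E} : (#|F| * #|F|.-1 <= #|F| * n.-1)%N by rewrite leq_mul2l -!subn1 leq_sub2r ?orbT.
rewrite mulnBl; lia.
Qed.

Lemma not_within_fixpoints_stable (n : nat) (sigma : 'S_n) (e : upair n) :
  (edge_perm sigma e \in not_within (fixpoints sigma)) = (e \in not_within (fixpoints sigma)).
Proof.
rewrite !inE permE /=; congr (~~ _); apply/subsetP/subsetP => h i ie.
  have := h (sigma i) (imset_f _ ie); rewrite !inE => /eqP/perm_inj/eqP //.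
by case/imsetP: ie => j /h hj ->; move: (hj); rewrite inE => /eqP ->.
Qed.

Lemma perm_upair_within_fixpoints (n : nat) (sigma : 'S_n) (e : upair n) :
  e \notin not_within (fixpoints sigma) -> perm_upair sigma e = e.
Proof.
rewrite inE negbK => /subsetP h; apply: val_inj => /=.
have E : {in val e, sigma =1 id} by move=> i /h; rewrite inE => /eqP.
by rewrite (eq_in_imset E) imset_id.
Qed.

(** Such an edge is {i, sigma i} for a vertex i. *)
Lemma card_fixed_not_within (n : nat) (sigma : 'S_n) :
  (#|[set e in not_within (fixpoints sigma) | edge_perm sigma e == e]| <= n)%N.
Proof.
rewrite -(card_imset _ val_inj) -[X in (_ <= X)%N]card_ord -cardsT.
apply: leq_trans (leq_imset_card (fun i : 'I_n => [set i; sigma i]) [set: 'I_n]).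
apply/subset_leq_card/subsetP => B /imsetP[e]; rewrite !inE permE => /andP[nF /eqP fe] ->.
case/subsetPn: nF => i ie; rewrite inE => ni; apply/imsetP; exists i => //.
apply/esym/eqP; rewrite eqEcard (eqP (valP e)) cards2 eq_sym ni andbT.
apply/subsetP => j; rewrite !inE => /orP[/eqP -> //|/eqP ->].
by rewrite -fe; apply: imset_f.
Qed.

(** * Error probability of maximum likelihood for fixed n *)

Lemma er_prob_le (R : realType) (n : nat) (p s c : R) (E : pred (outcome n)) :
  (forall pi : 'S_n,
     mean (edge_law p s) (fun X B => (E (pi, relabel pi^-1%g X, B))%:R) <= c) ->
  er_prob p s E <= c.
Proof.
move=> h; rewrite er_prob_mean.
have f0 : (0 : R) < (n`!)%:R by rewrite ltr0n fact_gt0.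
rewrite mulrC ler_pdivrMr //.
apply: le_trans (ler_sum _ (fun pi _ => h pi)) _.
by rewrite sumr_const card_Sn mulr_natr.
Qed.

Lemma fixpoints_mulV (n : nat) (sigma pi : 'S_n) :
  fixpoints (sigma * pi^-1)%g = [set i | sigma i == pi i].
Proof. by apply/setP => i; rewrite !inE permM (canF_eq (permKV pi)). Qed.

Lemma innerE (R : realType) (n : nat) (A B : adjvec n) :
  (inner A B)%:R = \sum_e (A e && B e)%:R :> R.
Proof. by rewrite natr_sum; apply: eq_bigr => e _; rewrite mulnb. Qed.

(** If pihat is wrong, sigma = pihat * pi^-1 does at least as well as the
    identity on the edges not within Fix(sigma), since the others are not moved.
    Hence the score of the identity is at most the level [t], an event that depends
    on Fix(sigma) only, or that of sigma is at least [t]. *)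
Lemma ml_error_le (R : realType) (n : nat) (p s : R) (pihat : estimator n)
    (K : pred {set 'I_n}) (t : {set 'I_n} -> R) :
  0 < p <= 1 -> 0 < s <= 1 -> is_ML pihat ->
  er_prob p s (fun w : outcome n =>
    let: (pi, A, B) := w in K [set i | pihat A B i == pi i]) <=
  \sum_(F | K F) mean (edge_law p s) (fun X B =>
     (\sum_(e in not_within F) (X e && B e)%:R <= t F)%R%:R) +
  \sum_(sigma : 'S_n | K (fixpoints sigma)) mean (edge_law p s) (fun X B =>
     (t (fixpoints sigma) <=
        \sum_(e in not_within (fixpoints sigma)) (X (edge_perm sigma e) && B e)%:R)%R%:R).
Proof.
move=> hp hs ML; apply: er_prob_le => pi.
rewrite -!mean_sum -meanD; apply: ler_mean => [a b|X B]; first exact: edge_law_ge0.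
set A := relabel _ X; set sigma := (pihat A B * pi^-1)%g.
have sum0 (I : finType) (Q : pred I) (f : I -> bool) : 0 <= \sum_(i | Q i) (f i)%:R :> R.
  by apply: sumr_ge0 => i _; rewrite ler0n.
have sum1 (I : finType) (Q : pred I) (f : I -> bool) i :
    Q i -> f i -> 1 <= \sum_(i | Q i) (f i)%:R :> R.
  by move=> Qi fi; rewrite (bigD1 i) //= fi lerDl sum0.
rewrite -fixpoints_mulV -/sigma.
have [KF|_] := boolP (K (fixpoints sigma)); last by rewrite addr_ge0.
set D := not_within (fixpoints sigma).
have D_le : \sum_(e in D) (X e && B e)%:R <=
            \sum_(e in D) (X (edge_perm sigma e) && B e)%:R :> R.
  have := ML A B pi; rewrite -(ler_nat R) !innerE relabelVK.
  have -> : relabel (pihat A B) A = relabel sigma X by rewrite relabelM.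
  rewrite (bigID (mem D)) [leRHS](bigID (mem D)) /=.
  have -> : \sum_(e | e \notin D) (relabel sigma X e && B e)%:R =
            \sum_(e | e \notin D) (X e && B e)%:R :> R.
    by apply: eq_bigr => e eD; rewrite ffunE perm_upair_within_fixpoints.
  rewrite lerD2r.
  have -> // : \sum_(e in D) (relabel sigma X e && B e)%:R =
            \sum_(e in D) (X (edge_perm sigma e) && B e)%:R :> R.
  by apply: eq_bigr => e _; rewrite ffunE permE.
have [h|h] := leP (\sum_(e in D) (X e && B e)%:R) (t (fixpoints sigma)).
  by rewrite -[leLHS]addr0 lerD ?sum0 // (sum1 _ _ _ (fixpoints sigma)).
rewrite -[leLHS]add0r lerD ?sum0 // (sum1 _ _ _ sigma) //.
exact: ltW (lt_le_trans h D_le).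
Qed.

Lemma card_fixpoints_le (n : nat) (F : {set 'I_n}) :
  (#|[set sigma : 'S_n | fixpoints sigma == F]| <= (n - #|F|)`!)%N.
Proof.
have -> : (n - #|F|)%N = #|~: F| by rewrite [RHS]cardsCs setCK card_ord.
rewrite -card_perm; apply/subset_leq_card/subsetP => sigma; rewrite inE => /eqP <-.
by apply/subsetP => i; rewrite !inE.
Qed.

Lemma edge_law_sum_and (R : realType) (p s x : R) :
  \sum_a \sum_b edge_law p s a b * expR (x * - (a && b)%:R) =
  1 - p * s ^+ 2 * (1 - expR (- x)).
Proof.
by rewrite !big_bool /= mulrN mulr1 mulrN mulr0 oppr0 expR0; ring.
Qed.

(** The Chernoff bound with parameter [eta]: the bound e^(-eta) <= 1/(1 + eta)
    gives the rate eta^3 / (1 + eta). *)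
Lemma matched_edges_tail (R : realType) (n : nat) (p s eta : R) (D : {set upair n}) :
  0 < p <= 1 -> 0 < s <= 1 -> 0 < eta <= 1 ->
  mean (edge_law p s) (fun X B =>
     (\sum_(e in D) (X e && B e)%:R <= (1 - eta) * (#|D|%:R * (p * s ^+ 2)))%R%:R) <=
  expR (- (eta ^+ 3 / 2 * (#|D|%:R * (p * s ^+ 2)))).
Proof.
move=> hp hs /andP[e0 e1].
set m := #|D|%:R; set r := p * s ^+ 2.
have r0 : 0 <= r by move/andP: hp => [/ltW ? _]; rewrite mulr_ge0 // sqr_ge0.
have r1 : r <= 1.
  move/andP: hp => [/ltW ? ?]; move/andP: hs => [/ltW ? ?].
  by rewrite mulr_ile1 ?sqr_ge0 // expr_le1.
have m0 : 0 <= m by rewrite ler0n.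
rewrite (@eq_mean _ _ _ _ (fun X B =>
  (- ((1 - eta) * (m * r)) <= \sum_(e in D) - (X e && B e)%:R)%R%:R)); last first.
  by move=> X B; rewrite sumrN lerN2.
apply: le_trans (chernoff (fun a b => - (a && b)%:R) D _ _ _ (ltW e0)) _.
- by move=> a b; exact: edge_law_ge0.
- exact: edge_law_total.
rewrite edge_law_sum_and -/r.
have E1 : expR (- eta) <= (1 + eta)^-1.
  rewrite expRN lef_pV2 ?posrE ?expR_gt0 //; last lra.
  exact: expR_ge1Dx.
have E2 : 1 - expR (- eta) >= eta / (1 + eta).
  have -> : eta / (1 + eta) = 1 - (1 + eta)^-1 by field; lra.
  lra.
have b0 : 0 <= 1 - r * (1 - expR (- eta)).
  rewrite subr_ge0; apply: mulr_ile1 => //; last by rewrite gerBl expR_ge0.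
  by rewrite subr_ge0 -expR0 ler_expR; lra.
have B1 : 1 - r * (1 - expR (- eta)) <= expR (- (r * (eta / (1 + eta)))).
  apply: le_trans (expR_ge1Dx _); rewrite lerD2l lerN2.
  by rewrite ler_wpM2l.
apply: le_trans (_ : expR (- (eta * - ((1 - eta) * (m * r)))) *
   expR (- (r * (eta / (1 + eta)))) ^+ #|D| <= _).
  by rewrite ler_wpM2l ?expR_ge0 // lerXn2r // nnegrE expR_ge0.
rewrite -expRM_natl -expRD ler_expR -/m.
have -> : - (eta * - ((1 - eta) * (m * r))) + m * (- (r * (eta / (1 + eta)))) =
   - (eta ^+ 3 / (1 + eta) * (m * r)) by field; lra.
rewrite lerN2; apply: ler_wpM2r; first exact: mulr_ge0.
apply: ler_wpM2l; first by rewrite exprn_ge0 // ltW.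
by rewrite lef_pV2 ?posrE; lra.
Qed.

Lemma sqrt_exp_le (R : realType) (x y : R) (m : nat) :
  x <= expR (2 * y) -> Num.sqrt x ^+ m <= expR (m%:R * y).
Proof.
move=> h; rewrite expRM_natl lerXn2r ?nnegrE ?sqrtr_ge0 ?expR_ge0 //.
rewrite -[leRHS]ger0_norm ?expR_ge0 // -sqrtr_sqr ler_wsqrtr //.
by rewrite -expRM_natl.
Qed.

(** The exponential moment at ln (1 + u), where (1 + u)^(XB) = 1 + u X B has the
    product form needed in [mean_prod_permuted_le] with phi = sqrt u on true. The
    squared norm of the moment matrix is 1 + 2 u q^2 + u^2 (q s)^2, q = p s. *)
Lemma mismatched_edges_tail (R : realType) (n : nat) (p s u t : R) (sigma : 'S_n) :
  0 < p <= 1 -> 0 < s <= 1 -> 0 <= u ->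
  mean (edge_law p s) (fun X B =>
     (t <= \sum_(e in not_within (fixpoints sigma)) (X (edge_perm sigma e) && B e)%:R)%R%:R) <=
  expR (#|not_within (fixpoints sigma)|%:R * (u * (p * s) ^+ 2 + u ^+ 2 * (p * s ^+ 2) ^+ 2 / 2) - ln (1 + u) * t) *
  Num.sqrt 2 ^+ n.
Proof.
move=> hp hs u0; set D := not_within _.
pose phi (a : bool) : R := if a then Num.sqrt u else 0.
have phiE a b : 1 + phi a * phi b = expR (ln (1 + u) * (a && b)%:R).
  rewrite /phi; case: a; case: b => /=; rewrite ?mulr0 ?mul0r ?mulr1 ?expR0 ?addr0 //.
  by rewrite -expr2 sqr_sqrtr // lnK // posrE; lra.
have l0 : 0 <= ln (1 + u) by rewrite ln_ge0 // lerDl.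
apply: le_trans (_ : mean (edge_law p s) (fun X B => expR (- (ln (1 + u) * t)) *
    \prod_(e in D) (1 + phi (X (edge_perm sigma e)) * phi (B e))) <= _).
  apply: ler_mean => [a b|X B]; first exact: edge_law_ge0.
  apply: le_trans (ler_nat_expR _ _ l0) _; rewrite ler_wpM2l ?expR_ge0 //.
  rewrite mulr_sumr expR_sum le_eqVlt; apply/orP; left; apply/eqP.
  by apply: eq_bigr => e _; rewrite phiE.
rewrite meanZ expRD [X in _ <= X * _]mulrC -[leRHS]mulrA.
apply: ler_wpM2l; first exact: expR_ge0.
apply: le_trans (mean_prod_permuted_le _ (edge_law_total p s) _) _.
  by move=> e; exact: not_within_fixpoints_stable.
apply: ler_pM; rewrite ?exprn_ge0 ?sqrtr_ge0 //; last first.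
  rewrite ler_weXn2l //; last exact: card_fixed_not_within.
  by rewrite -[leLHS]sqrtr1 ler_wsqrtr // ler1n.
apply: sqrt_exp_le; apply: le_trans (expR_ge1Dx _).
have U : Num.sqrt u ^+ 2 = u by rewrite sqr_sqrtr.
have -> : \sum_c \sum_d gram (edge_law p s) phi c d ^+ 2 =
   1 + 2 * (Num.sqrt u ^+ 2 * (p * s) ^+ 2) + Num.sqrt u ^+ 2 ^+ 2 * (p * s ^+ 2) ^+ 2.
  by rewrite /gram /phi !big_bool /=; ring.
by rewrite U; lra.
Qed.
Lemma fact_le_expn (n k : nat) : (k <= n)%N -> (k`! <= n ^ k)%N.
Proof.
elim: k => [|k IH] kn; first by rewrite expn0.
by rewrite factS expnS leq_mul // IH // ltnW.
Qed.

Lemma sum_sets_le (R : realType) (n : nat) (K : pred {set 'I_n}) (f : {set 'I_n} -> R) (c : R) :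
  0 <= c -> (forall F, K F -> f F <= c) -> \sum_(F | K F) f F <= 2 ^+ n * c.
Proof.
move=> c0 fc; rewrite big_mkcond /=.
have -> : 2 ^+ n * c = \sum_(F : {set 'I_n}) c.
  by rewrite sumr_const -cardsT -powersetT card_powerset cardsT card_ord -[RHS]mulr_natl natrX.
by apply: ler_sum => F _; case: ifP => // /fc.
Qed.

(** The two unions of [ml_error_le] are bounded separately. At most (n - |F|)!
    permutations have fixed point set F, that is e^((n - |F|) ln n), and the
    hypothesis says that the exponent gained on the at least (n - |F|)(n - 1)/2
    edges exceeds this by the factor 1 + eps. *)
Lemma ml_error_bound (R : realType) (n : nat) (p s u eta eps delta : R) (pihat : estimator n) :
  (1 < n)%N -> 0 < p <= 1 -> 0 < s <= 1 -> 0 <= u -> 0 < eta <= 1 -> 0 <= eps -> delta <= 1 ->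
  (1 + eps) * ln n%:R <= n.-1%:R / 2 *
    ((1 - eta) * (p * s ^+ 2) * ln (1 + u) - (u * (p * s) ^+ 2 + u ^+ 2 * (p * s ^+ 2) ^+ 2 / 2)) ->
  is_ML pihat ->
  er_prob p s (fun w : outcome n =>
    let: (pi, A, B) := w in #|[set i | pihat A B i == pi i]|%:R < delta * n%:R) <=
  2 ^+ n * (expR (- (eta ^+ 3 / 4 * (p * s ^+ 2) * ((1 - delta) * n%:R * n.-1%:R))) +
            Num.sqrt 2 ^+ n * expR (- (eps * (1 - delta) * n%:R * ln n%:R))).
Proof.
move=> n1 hp hs u0 heta eps0 d1 H ML.
set r := p * s ^+ 2 in H *; set G := (X in _ <= _ * X) in H.
pose t (F : {set 'I_n}) := (1 - eta) * (#|not_within F|%:R * r).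
apply: le_trans (ml_error_le (fun F => #|F|%:R < delta * n%:R) t hp hs ML) _.
have /andP[p0 p1] := hp; have /andP[s0 s1] := hs; have /andP[e0 e1] := heta.
have r0 : 0 <= r by rewrite mulr_ge0 ?sqr_ge0 // ltW.
have n0 : (0 : R) < n.-1%:R by rewrite ltr0n; case: (n) n1 => [|[]].
have lnn : 0 <= ln n%:R :> R by rewrite ln_ge0 // ler1n ltnW.
have G0 : 0 <= G.
  have : 0 <= n.-1%:R / 2 * G by apply: le_trans H; rewrite mulr_ge0 // addr_ge0.
  by rewrite pmulr_rge0 // divr_gt0.
have fn (F : {set 'I_n}) : (#|F| <= n)%N by rewrite -[X in (_ <= X)%N]card_ord max_card.
have touch (F : {set 'I_n}) : (n%:R - #|F|%:R) * n.-1%:R / 2 <= #|not_within F|%:R :> R.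
  rewrite ler_pdivrMr // mulr_natr -natrB // -natrM -mulrnA muln2 ler_nat.
  exact: card_not_within.
rewrite mulrDr; apply: lerD.
  apply: sum_sets_le => [|F KF]; first exact: expR_ge0.
  apply: le_trans (matched_edges_tail _ hp hs heta) _; rewrite ler_expR lerN2 -/r.
  have -> : eta ^+ 3 / 4 * r * ((1 - delta) * n%:R * n.-1%:R) =
    eta ^+ 3 / 2 * ((1 - delta) * n%:R * n.-1%:R / 2 * r) by field.
  apply: ler_wpM2l; first by rewrite divr_ge0 // exprn_ge0 // ltW.
  apply: ler_wpM2r => //; apply: le_trans (touch F).
  rewrite -[leLHS]mulrA -[leRHS]mulrA; apply: ler_wpM2r; first by rewrite divr_ge0 // ltW.
  by move: KF; lra.
rewrite (partition_big (@fixpoints n) (fun F => #|F|%:R < delta * n%:R)) //=.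
apply: sum_sets_le => [|F KF]; first by rewrite mulr_ge0 ?exprn_ge0 ?sqrtr_ge0 ?expR_ge0.
pose c : R := expR (- (#|not_within F|%:R * G)) * Num.sqrt 2 ^+ n.
apply: (@le_trans _ _ (\sum_(sigma in [set sigma | fixpoints sigma == F]) c)).
  rewrite (eq_bigl (fun sigma => sigma \in [set sigma | fixpoints sigma == F])) /=; last first.
    by move=> sigma; rewrite inE; apply/andP/idP => [[] //|/eqP ->]; rewrite eqxx.
  apply: ler_sum => sigma; rewrite inE => /eqP eF; rewrite /c -eF.
  apply: le_trans (mismatched_edges_tail _ sigma hp hs u0) _.
  rewrite ler_wpM2r ?exprn_ge0 ?sqrtr_ge0 // ler_expR le_eqVlt.
  by apply/orP; left; apply/eqP; rewrite /G /t -/r; ring.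
rewrite sumr_const -[leLHS]mulr_natl /c mulrA [leRHS]mulrC.
apply: ler_wpM2r; first by rewrite exprn_ge0 ?sqrtr_ge0.
apply: le_trans (_ : expR ((n%:R - #|F|%:R) * ln n%:R) * expR (- (#|not_within F|%:R * G)) <= _).
  apply: ler_wpM2r; first exact: expR_ge0.
  rewrite -natrB // expRM_natl lnK ?posrE ?ltr0n 1?ltnW // -natrX ler_nat.
  by apply: leq_trans (card_fixpoints_le F) _; exact/fact_le_expn/leq_subr.
rewrite -expRD ler_expR.
have T1 := ler_wpM2r G0 (touch F).
have f0 : 0 <= n%:R - #|F|%:R :> R by rewrite subr_ge0 ler_nat.
have T2 := ler_wpM2l f0 H.
have T3 : (1 - delta) * n%:R <= n%:R - #|F|%:R by move: KF; lra.
have T4 := ler_wpM2r (mulr_ge0 eps0 lnn) T3.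
move: T1 T2 T4; lra.
Qed.

(** * Likelihood ratio and second moment of the agreement with an estimator *)

Definition edge_marginal (R : realType) (p s : R) (a : bool) : R :=
  if a then p * s else 1 - p * s.

Definition edge_lr (R : realType) (p s : R) (a b : bool) : R :=
  edge_law p s a b / (edge_marginal p s a * edge_marginal p s b).

(** The correlation coefficient of the two Bernoulli variables. *)
Definition edge_corr (R : realType) (p s : R) : R := (s - p * s) / (1 - p * s).

Lemma weighted_cauchy (R : realType) (I : finType) (w f : I -> R) :
  (forall i, 0 <= w i) -> \sum_i w i = 1 ->
  (\sum_i w i * f i) ^+ 2 <= \sum_i w i * f i ^+ 2.
Proof.
move=> w0 w1; set m := \sum_i w i * f i.
have : 0 <= \sum_i w i * (f i - m) ^+ 2 by apply: sumr_ge0 => i _; rewrite mulr_ge0 ?sqr_ge0.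
have -> : \sum_i w i * (f i - m) ^+ 2 = \sum_i w i * f i ^+ 2 - 2 * m * m + m ^+ 2 * 1.
  transitivity (\sum_i (w i * f i ^+ 2 - 2 * m * (w i * f i) + m ^+ 2 * w i)).
    by apply: eq_bigr => i _; ring.
  by rewrite !big_split /= sumrN -!mulr_sumr w1.
by nra.
Qed.

Section LikelihoodRatio.
Variables (R : realType) (p s : R).
Hypotheses (hp : 0 < p < 1) (hs : 0 < s <= 1).

Let p0 : 0 < p. Proof. by case/andP: hp. Qed.
Let s0 : 0 < s. Proof. by case/andP: hs. Qed.
Let q0 : 0 < p * s. Proof. by case/andP: hp => ? _; case/andP: hs => ? _; exact: mulr_gt0. Qed.
Let q1 : p * s < 1.
Proof. by move/andP: hp => [? ?]; move/andP: hs => [? ?]; apply: le_lt_trans (_ : p * 1 < 1); [rewrite ler_pM2l|rewrite mulr1]. Qed.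
Let hp' : 0 < p <= 1. Proof. by case/andP: hp => [-> /ltW ->]. Qed.

Lemma edge_marginal_gt0 a : 0 < edge_marginal p s a.
Proof. by rewrite /edge_marginal; case: a => //; rewrite subr_gt0. Qed.

Lemma edge_law_lr a b :
  edge_law p s a b = edge_marginal p s a * edge_marginal p s b * edge_lr p s a b.
Proof. by rewrite /edge_lr mulrC divfK // mulf_neq0 // gt_eqF // edge_marginal_gt0. Qed.

Lemma edge_lr_ge0 a b : 0 <= edge_lr p s a b.
Proof.
by rewrite divr_ge0 ?edge_law_ge0 // mulr_ge0 // ltW // edge_marginal_gt0.
Qed.

Lemma edge_corr_ge0 : 0 <= edge_corr p s.
Proof.
rewrite divr_ge0 // subr_ge0 ?(ltW q1) //.
by rewrite ler_piMl // ltW //; case/andP: hp.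
Qed.

Let phi (a : bool) : R :=
  Num.sqrt (edge_corr p s / (p * s * (1 - p * s))) * ((if a then 1 else 0) - p * s).

Let phiM a b :
  phi a * phi b = edge_corr p s / (p * s * (1 - p * s)) * (((if a then 1 else 0) - p * s) * ((if b then 1 else 0) - p * s)).
Proof.
rewrite /phi mulrACA -expr2 sqr_sqrtr // divr_ge0 ?edge_corr_ge0 // mulr_ge0 //.
  exact: ltW.
by rewrite subr_ge0 ltW.
Qed.

Let edge_lrE a b : edge_lr p s a b = 1 + phi a * phi b.
Proof.
rewrite phiM /edge_lr /edge_corr /edge_law /edge_marginal.
have h1 : 1 - p * s != 0 by rewrite subr_eq0 eq_sym lt_eqF.
have h2 : s != 0 by rewrite gt_eqF.
have h3 : p != 0 by rewrite gt_eqF.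
by case: a; case: b => /=; field; rewrite ?h1 ?h2 ?h3.
Qed.

(** The likelihood ratio is 1 + rho psi(a) psi(b), with rho the correlation and
    psi the standardized variable. So [mean_prod_permuted_le] applies with
    phi = sqrt rho psi, and the moment matrix is diagonal, with entries 1 and
    rho^2. *)
Lemma mean_lr_le (n : nat) (sigma : 'S_n) :
  mean (edge_law p s) (fun X B => \prod_(e in not_within (fixpoints sigma))
     edge_lr p s (X (edge_perm sigma e)) (B e)) <=
  expR (#|not_within (fixpoints sigma)|%:R * (edge_corr p s ^+ 4 / 2)) * Num.sqrt 2 ^+ n.
Proof.
set D := not_within _.
have := mean_prod_permuted_le phi (edge_law_total p s) (not_within_fixpoints_stable sigma).
have -> : \sum_c \sum_d gram (edge_law p s) phi c d ^+ 2 = 1 + edge_corr p s ^+ 4.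
  have E c d : gram (edge_law p s) phi c d =
      if c then (if d then edge_corr p s ^+ 2 else 0) else (if d then 0 else 1).
    rewrite /gram; case: c; case: d; rewrite !big_bool /= ?phiM ?mul1r ?mulr1; last by ring.
    - rewrite /edge_corr.
      have h1 : 1 - p * s != 0 by rewrite subr_eq0 eq_sym lt_eqF.
      have h2 : s != 0 by rewrite gt_eqF.
      have h3 : p != 0 by rewrite gt_eqF.
      by rewrite /=; field; rewrite ?h1 ?h2 ?h3.
    - by rewrite /phi /=; ring.
    - by rewrite /phi /=; ring.
  by rewrite !big_bool /= !E; ring.
move=> H; apply: le_trans (_ : Num.sqrt (1 + edge_corr p s ^+ 4) ^+ #|D| *
   Num.sqrt 2 ^+ #|[set e in D | edge_perm sigma e == e]| <= _).
  apply: le_trans H; rewrite le_eqVlt; apply/orP; left; apply/eqP.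
  by apply: eq_mean => X B; apply: eq_bigr => e _; rewrite edge_lrE.
apply: ler_pM; rewrite ?exprn_ge0 ?sqrtr_ge0 //; last first.
  rewrite ler_weXn2l //; last exact: card_fixed_not_within.
  by rewrite -[leLHS]sqrtr1 ler_wsqrtr // ler1n.
apply: sqrt_exp_le; apply: le_trans (expR_ge1Dx _).
by rewrite lerD2l mulrC divfK // pnatr_eq0.
Qed.

Lemma sum_marginals (V : finType) :
  \sum_(w : {ffun V -> bool} * {ffun V -> bool})
    \prod_e (edge_marginal p s (w.1 e) * edge_marginal p s (w.2 e)) = 1.
Proof.
rewrite -(pair_bigA _ (fun X B : {ffun V -> bool} =>
  \prod_e (edge_marginal p s (X e) * edge_marginal p s (B e)))) /=.
transitivity (mean (fun a b => edge_marginal p s a * edge_marginal p s b)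
  (fun X B : {ffun V -> bool} => \prod_(e : V) 1)).
  by apply: eq_bigr => X _; apply: eq_bigr => B _; rewrite big1_eq mulr1.
rewrite (mean_prod _ (fun _ _ _ => 1)) big1 // => e _.
by rewrite !big_bool /edge_marginal /=; ring.
Qed.

Lemma prod_edge_law_lr (n : nat) (pi : 'S_n) (A B : adjvec n) :
  \prod_e edge_law p s (relabel pi A e) (B e) =
  \prod_e (edge_marginal p s (A e) * edge_marginal p s (B e)) *
  \prod_e edge_lr p s (relabel pi A e) (B e).
Proof.
rewrite [X in _ = X * _]big_split /= [X in _ = X * _ * _](reindex_inj (@perm_upair_inj n pi)) /=.
rewrite -!big_split /=; apply: eq_bigr => e _.
by rewrite edge_law_lr ffunE.
Qed.

End LikelihoodRatio.

Section SecondMoment.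
Variables (R : realType) (p s : R).
Hypotheses (hp : 0 < p < 1) (hs : 0 < s <= 1).

Let hp' : 0 < p <= 1. Proof. by case/andP: hp => [-> /ltW ->]. Qed.

Let null (n : nat) (w : adjvec n * adjvec n) : R :=
  \prod_e (edge_marginal p s (w.1 e) * edge_marginal p s (w.2 e)).

Let lr (n : nat) (pi : 'S_n) (w : adjvec n * adjvec n) : R :=
  \prod_e edge_lr p s (relabel pi w.1 e) (w.2 e).

Let null_ge0 n w : 0 <= @null n w.
Proof. by apply: prodr_ge0 => e _; rewrite mulr_ge0 // ltW // edge_marginal_gt0. Qed.

Let lr_ge0 n pi w : 0 <= @lr n pi w.
Proof. by apply: prodr_ge0 => e _; exact: edge_lr_ge0. Qed.

(** Change of measure from the model given pi to independent A and B. *)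
Lemma mean_null (n : nat) (pi : 'S_n) (f : adjvec n -> adjvec n -> R) :
  mean (edge_law p s) f = \sum_w null w * (lr pi w * f (relabel pi w.1) w.2).
Proof.
rewrite /mean (reindex_inj (can_inj (@relabelK n pi))) /= pair_bigA /=.
by apply: eq_bigr => w _; rewrite prod_edge_law_lr // mulrA.
Qed.

(** The left side is the square of an expectation under independent A and B, at
    most the expectation of the square. Expanding the square gives pairs pi, pi'
    that coincide with pihat on [F], hence with each other; by symmetry only
    sigma = pi' * pi^-1 matters, and one of the two likelihood ratios is absorbed
    in the change of measure. *)
Lemma agreement_second_moment (n : nat) (pihat : estimator n) (F : {set 'I_n})
    (good : adjvec n -> adjvec n -> bool) :
  ((n`!)%:R^-1 * \sum_(pi : 'S_n) mean (edge_law p s) (fun X B =>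
     (([set i | pihat (relabel pi^-1%g X) B i == pi i] == F) && good X B)%:R)) ^+ 2 <=
  (n`!)%:R^-1 * \sum_(sigma : 'S_n | F \subset fixpoints sigma)
     mean (edge_law p s) (fun X B => (good X B)%:R *
        \prod_e edge_lr p s (relabel sigma X e) (B e)).
Proof.
set f := (n`!)%:R^-1.
have f0 : 0 < f by rewrite invr_gt0 ltr0n fact_gt0.
pose I (pi : 'S_n) (w : adjvec n * adjvec n) :=
  ([set i | pihat w.1 w.2 i == pi i] == F) && good (relabel pi w.1) w.2.
have -> : f * \sum_(pi : 'S_n) mean (edge_law p s) (fun X B =>
     (([set i | pihat (relabel pi^-1%g X) B i == pi i] == F) && good X B)%:R) =
    \sum_w null w * (f * \sum_(pi : 'S_n) lr pi w * (I pi w)%:R).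
  under eq_bigr => pi _ do rewrite (mean_null pi).
  rewrite exchange_big mulr_sumr; apply: eq_bigr => w _.
  rewrite mulrCA -mulr_sumr; congr (_ * (_ * _)); apply: eq_bigr => pi _.
  by rewrite relabelK.
apply: le_trans (weighted_cauchy _ (@null_ge0 n) _) _; first exact: sum_marginals.
pose M (sigma : 'S_n) := mean (edge_law p s) (fun X B => (good X B)%:R *
        \prod_e edge_lr p s (relabel sigma X e) (B e)).
have Mpi (pi : 'S_n) : \sum_(sigma | F \subset fixpoints sigma) M sigma =
    \sum_(pi' | F \subset fixpoints (pi' * pi^-1)%g)
      \sum_w null w * (lr pi w * (lr pi' w * (good (relabel pi w.1) w.2)%:R)).
  rewrite [RHS](reindex_inj (mulIg pi)) /=; apply: eq_big => [sigma|sigma _].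
    by rewrite mulgK.
  rewrite /M (mean_null pi); apply: eq_bigr => w _.
  by rewrite relabelM [_%:R * _]mulrC.
have -> : f * \sum_(sigma | F \subset fixpoints sigma) M sigma =
    f ^+ 2 * \sum_(pi : 'S_n) \sum_(sigma | F \subset fixpoints sigma) M sigma.
  rewrite sumr_const card_Sn -(mulr_natl (\sum_(sigma | _) _)) mulrA expr2.
  by rewrite -(mulrA f f) /f mulVf ?mulr1 // pnatr_eq0 -lt0n fact_gt0.
under [X in _ <= _ * X]eq_bigr => pi _ do rewrite (Mpi pi) exchange_big.
rewrite exchange_big mulr_sumr; apply: ler_sum => w _.
under [X in _ <= _ * X]eq_bigr => pi _ do rewrite -mulr_sumr.
rewrite -[X in _ <= _ * X]mulr_sumr [leRHS]mulrCA.
apply: ler_wpM2l => //; rewrite exprMn; apply: ler_wpM2l; first exact: sqr_ge0.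
rewrite expr2 mulr_suml; apply: ler_sum => pi _.
rewrite mulr_sumr [leRHS]big_mkcond /=; apply: ler_sum => pi' _.
have [/andP[/eqP e1 e2]|_] := boolP (I pi w); last first.
  by rewrite mulr0 mul0r; case: ifP => // _; rewrite !mulr_ge0 // ler0n.
have [/andP[/eqP e1' e2']|_] := boolP (I pi' w); last first.
  by rewrite !mulr0; case: ifP => // _; rewrite !mulr_ge0 // ler0n.
have -> : F \subset fixpoints (pi' * pi^-1)%g.
  apply/subsetP => i iF; rewrite fixpoints_mulV inE.
  have := iF; rewrite -{1}e1 inE => /eqP <-.
  by have := iF; rewrite -{1}e1' inE eq_sym.
by rewrite e2 !mulr1 lexx.
Qed.

End SecondMoment.

(** * Error probability of an arbitrary estimator for fixed n *)

(** Either the truncation event fails, or the agreement set is some F in [K];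
    each of the latter is bounded by [agreement_second_moment]. *)
Lemma estimator_agreement_le (R : realType) (n : nat) (p s : R) (pihat : estimator n)
    (K : pred {set 'I_n}) (good : adjvec n -> adjvec n -> bool) :
  0 < p < 1 -> 0 < s <= 1 ->
  er_prob p s (fun w : outcome n =>
    let: (pi, A, B) := w in K [set i | pihat A B i == pi i]) <=
  mean (edge_law p s) (fun X B => (~~ good X B)%:R) +
  \sum_(F | K F) Num.sqrt ((n`!)%:R^-1 * \sum_(sigma : 'S_n | F \subset fixpoints sigma)
     mean (edge_law p s) (fun X B => (good X B)%:R *
        \prod_e edge_lr p s (relabel sigma X e) (B e))).
Proof.
move=> hp hs; have hp' : 0 < p <= 1 by case/andP: hp => [-> /ltW ->].
rewrite er_prob_mean; set f := (n`!)%:R^-1.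
have ffact : f * (n`!)%:R = 1 by rewrite mulVf // pnatr_eq0 -lt0n fact_gt0.
have f0 : 0 <= f by rewrite invr_ge0 ler0n.
pose agree F (pi : 'S_n) (X B : adjvec n) : R :=
  (([set i | pihat (relabel pi^-1%g X) B i == pi i] == F) && good X B)%:R.
apply: le_trans (_ : f * \sum_(pi : 'S_n) (mean (edge_law p s) (fun X B => (~~ good X B)%:R) +
   \sum_(F | K F) mean (edge_law p s) (agree F pi)) <= _).
  apply: ler_wpM2l => //; apply: ler_sum => pi _.
  rewrite -mean_sum -meanD; apply: ler_mean => [a b|X B]; first exact: edge_law_ge0.
  set S := [set i | _].
  have S0 : 0 <= \sum_(F | K F) agree F pi X B by apply: sumr_ge0 => F _; rewrite ler0n.
  have [gd|_] := boolP (good X B); last by rewrite -[leLHS]addr0 lerD // lern1 leq_b1.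
  have [KS|_] := boolP (K S); last by rewrite addr_ge0.
  rewrite add0r (bigD1 S) //= {1}/agree eqxx gd /= lerDl.
  by apply: sumr_ge0 => F _; rewrite ler0n.
rewrite big_split /= mulrDr sumr_const card_Sn -[X in f * X]mulr_natl mulrA ffact mul1r.
rewrite lerD2l exchange_big mulr_sumr; apply: ler_sum => F _.
apply: le_trans (ler_norm _) _; rewrite -sqrtr_sqr ler_wsqrtr //.
exact: agreement_second_moment.
Qed.

(** Stirling's lower bound (k/e)^k <= k!, by induction from (1 + 1/k)^k <= e. *)
Lemma fact_ge_expR (R : realType) (k : nat) :
  expR (k%:R * ln k%:R - k%:R) <= (k`!)%:R :> R.
Proof.
elim: k => [|k IH]; first by rewrite mul0r subr0 expR0.
have k1 : (0 : R) < k.+1%:R by rewrite ltr0n.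
rewrite factS natrM.
have -> : k.+1%:R * ln k.+1%:R - k.+1%:R = ln k.+1%:R + (k%:R * ln k.+1%:R - k.+1%:R) :> R.
  by rewrite -[k.+1]addn1 natrD; ring.
rewrite expRD lnK ?posrE //; apply: ler_wpM2l; first exact: ltW.
apply: le_trans IH; rewrite ler_expR.
case: k k1 => [|k] k1; first by rewrite !mul0r !sub0r; lra.
have k0 : (0 : R) < k.+1%:R by rewrite ltr0n.
have H : k.+1%:R * (ln k.+2%:R - ln k.+1%:R) <= 1 :> R.
  rewrite -ln_div ?posrE //.
  have -> : k.+2%:R / k.+1%:R = 1 + k.+1%:R^-1 :> R.
    by rewrite -[k.+2]addn1 natrD mulrDl mul1r divff // gt_eqF.
  apply: le_trans (_ : k.+1%:R * k.+1%:R^-1 <= _); last by rewrite divff // gt_eqF.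
  rewrite ler_pM2l //; apply: le_ln1Dx.
  by apply: lt_trans (_ : 0 < _); rewrite ?ltrN10 // invr_gt0.
have E : k.+2%:R = k.+1%:R + 1 :> R by rewrite -natr1.
move: H E; move: (ln _) (ln _) => a b.
by move: (k.+2%:R) (k.+1%:R) => x y; nra.
Qed.

Lemma fact_ratio_le (n k : nat) : (k <= n)%N -> ((n - k)`! * k`! <= n`!)%N.
Proof. by move=> kn; rewrite -(bin_fact kn) mulnC leq_pmull // bin_gt0. Qed.

(** A set of size k is the fixed point set of at most (n - k)! of the n!
    permutations, a proportion of at most 1/k!. *)
Lemma sum_fixpoints_le (R : realType) (n : nat) (F : {set 'I_n}) (K : pred {set 'I_n})
    (g : 'S_n -> R) (b : nat -> R) :
  (forall sigma, F \subset fixpoints sigma -> K (fixpoints sigma)) ->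
  (forall k, 0 <= b k) ->
  (forall sigma, F \subset fixpoints sigma -> g sigma <= b #|fixpoints sigma|) ->
  (n`!)%:R^-1 * \sum_(sigma | F \subset fixpoints sigma) g sigma <=
  \sum_(F' | K F') b #|F'| / (#|F'|)`!%:R.
Proof.
move=> KF b0 gb.
have fgt (k : nat) : (0 : R) < (k`!)%:R by rewrite ltr0n fact_gt0.
rewrite ler_pdivrMl // (partition_big (@fixpoints n) K) //= mulr_sumr.
apply: ler_sum => F' KF'.
apply: (@le_trans _ _ (\sum_(sigma in [set sigma | fixpoints sigma == F']) b #|F'|)).
  rewrite [leRHS]big_mkcond [leLHS]big_mkcond /=; apply: ler_sum => sigma _; rewrite inE.
  case: (eqVneq (fixpoints sigma) F') => [<-|_]; last by rewrite andbF.
  by rewrite andbT; case: ifP => // /gb.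
rewrite sumr_const -[leLHS]mulr_natl mulrCA mulrC ler_wpM2l // ler_pdivlMr // -natrM ler_nat.
have Fn : (#|F'| <= n)%N by rewrite -[X in (_ <= X)%N]card_ord max_card.
apply: leq_trans (fact_ratio_le Fn); rewrite leq_mul2r card_fixpoints_le orbT //.
Qed.

(** The truncation event bounds the log-likelihood ratio of the edges within
    every large set F by tau |F|. A Chernoff bound with parameter [x] makes its
    failure unlikely. In the second moment the edges within Fix(sigma) then
    contribute at most e^(tau |Fix sigma|), against the proportion
    1/|Fix sigma|! <= (e/(delta n))^|Fix sigma| of such sigma, and the remaining
    edges at most e^(n^2 rho^4 / 4) sqrt(2)^n. *)
Lemma estimator_error_bound (R : realType) (n : nat) (p s delta tau gamma x y : R)
    (v : bool -> bool -> R) (pihat : estimator n) :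
  (0 < n)%N -> 0 < p < 1 -> 0 < s <= 1 -> 0 < delta ->
  (forall a b, edge_lr p s a b <= expR (v a b)) ->
  0 <= x -> 0 <= y -> 0 <= gamma ->
  \sum_a \sum_b edge_law p s a b * expR (x * v a b) <= expR y ->
  y * n%:R / 2 <= x * (tau - gamma) ->
  0 <= ln n%:R - tau + ln delta - 1 ->
  er_prob p s (fun w : outcome n =>
    let: (pi, A, B) := w in delta * n%:R < #|[set i | pihat A B i == pi i]|%:R) <=
  2 ^+ n * expR (- (x * gamma * (delta * n%:R))) +
  2 ^+ n * Num.sqrt (2 ^+ n * (Num.sqrt 2 ^+ n *
    expR (n%:R ^+ 2 * edge_corr p s ^+ 4 / 4 - (ln n%:R - tau + ln delta - 1) * (delta * n%:R)))).
Proof.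
move=> n0 hp hs d0 hv x0 y0 g0 hy hgap; set a := _ - 1 => a0.
have hp' : 0 < p <= 1 by case/andP: hp => [-> /ltW ->].
have P0 a' b' : 0 <= edge_law p s a' b' by exact: edge_law_ge0.
have nR : (0 : R) < n%:R by rewrite ltr0n.
pose K (F : {set 'I_n}) := delta * n%:R < #|F|%:R :> R.
have Fn (F : {set 'I_n}) : (#|F| <= n)%N by rewrite -[X in (_ <= X)%N]card_ord max_card.
pose W (F : {set 'I_n}) (X B : adjvec n) : R := \sum_(e in ~: not_within F) v (X e) (B e).
pose good (X B : adjvec n) := [forall F, K F ==> (W F X B <= tau * #|F|%:R)].
apply: le_trans (estimator_agreement_le pihat K good hp hs) _.
apply: lerD.
  apply: le_trans (_ : \sum_(F | K F) mean (edge_law p s) (fun X B =>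
      (tau * #|F|%:R <= W F X B)%R%:R) <= _).
    rewrite -mean_sum; apply: ler_mean => // X B.
    have [_|/forallPn[F]] := boolP (good X B); first by rewrite sumr_ge0.
    rewrite negb_imply -ltNge => /andP[KF /ltW h].
    by rewrite (bigD1 F) //= h lerDl sumr_ge0.
  apply: sum_sets_le => [|F KF]; first exact: expR_ge0.
  apply: le_trans (chernoff v _ _ P0 (edge_law_total p s) x0) _.
  apply: le_trans (_ : expR (- (x * (tau * #|F|%:R))) * expR y ^+ #|~: not_within F| <= _).
    apply: ler_wpM2l; first exact: expR_ge0.
    rewrite lerXn2r // nnegrE ?expR_ge0 //.
    by apply: sumr_ge0 => a' _; apply: sumr_ge0 => b' _; rewrite mulr_ge0 // expR_ge0.
  rewrite -expRM_natl -expRD ler_expR card_within.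
  have B2 : ('C(#|F|, 2)%:R : R) * y <= y * n%:R / 2 * #|F|%:R.
    have -> : y * n%:R / 2 * #|F|%:R = n%:R * #|F|%:R / 2 * y by ring.
    apply: ler_wpM2r => //; rewrite ler_pdivlMr // -!natrM ler_nat bin2.
    have := Fn F; move: (#|F|) => f fn; rewrite muln2.
    apply: leq_trans (_ : f * f.-1 <= _)%N; last by rewrite mulnC leq_mul2r (leq_trans (leq_pred _) fn) orbT.
    by rewrite -[leqRHS]odd_double_half leq_addl.
  have B3 := ler_wpM2r (ler0n R #|F|) hgap.
  have B4 : x * gamma * (delta * n%:R) <= x * gamma * #|F|%:R.
    by apply: ler_wpM2l; rewrite ?mulr_ge0 // ltW.
  by move: B2 B3 B4; lra.
apply: sum_sets_le => [|F KF]; first exact: sqrtr_ge0.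
rewrite ler_wsqrtr //.
set rho := edge_corr p s.
pose b (k : nat) : R := if delta * n%:R < k%:R then
  expR (tau * k%:R) * (expR (n%:R ^+ 2 * rho ^+ 4 / 4) * Num.sqrt 2 ^+ n) else 0.
have Kup sigma : F \subset fixpoints sigma -> K (fixpoints sigma).
  by move=> /subset_leq_card h; apply: lt_le_trans KF _; rewrite ler_nat.
apply: le_trans (sum_fixpoints_le (b := b) Kup _ _) _.
- move=> k; rewrite /b; case: ifP => // _.
  by rewrite !mulr_ge0 ?expR_ge0 // exprn_ge0 ?sqrtr_ge0.
- move=> sigma /Kup Ks; rewrite /b -/(K _) Ks.
  apply: le_trans (_ : mean (edge_law p s) (fun X B => expR (tau * #|fixpoints sigma|%:R) *
    \prod_(e in not_within (fixpoints sigma)) edge_lr p s (X (edge_perm sigma e)) (B e)) <= _).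
    apply: ler_mean => // X B.
    have lr0 (e : upair n) : 0 <= edge_lr p s (relabel sigma X e) (B e) by exact: edge_lr_ge0.
    have [gd|_] := boolP (good X B); last first.
      rewrite mul0r mulr_ge0 ?expR_ge0 // prodr_ge0 // => e _; exact: edge_lr_ge0.
    rewrite mul1r (bigID (mem (not_within (fixpoints sigma)))) /= mulrC.
    have -> : \prod_(e in not_within (fixpoints sigma)) edge_lr p s (relabel sigma X e) (B e) =
      \prod_(e in not_within (fixpoints sigma)) edge_lr p s (X (edge_perm sigma e)) (B e).
      by apply: eq_bigr => e _; rewrite ffunE permE.
    apply: ler_wpM2r; first by apply: prodr_ge0 => e _; exact: edge_lr_ge0.
    move/forallP/(_ (fixpoints sigma)): gd; rewrite Ks /= -(ler_expR (W _ _ _)) /W.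
    apply: le_trans; rewrite expR_sum.
    rewrite (eq_bigl (fun e => e \notin not_within (fixpoints sigma))); last by move=> e; rewrite inE.
    rewrite [leRHS](eq_bigl (fun e => e \notin not_within (fixpoints sigma))); last by move=> e; rewrite inE.
    apply: ler_prod => e eD; rewrite lr0 /= ffunE perm_upair_within_fixpoints //.
  rewrite meanZ; apply: ler_wpM2l; first exact: expR_ge0.
  apply: le_trans (mean_lr_le hp hs sigma) _.
  apply: ler_wpM2r; first by rewrite exprn_ge0 ?sqrtr_ge0.
  rewrite ler_expR -/rho.
  have -> : n%:R ^+ 2 * rho ^+ 4 / 4 = n%:R ^+ 2 / 2 * (rho ^+ 4 / 2) by field.
  apply: ler_wpM2r; first by rewrite divr_ge0 // exprn_ge0 // edge_corr_ge0.
  rewrite ler_pdivlMr // -natrX -natrM ler_nat.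
  apply: leq_trans (_ : #|{: upair n}| * 2 <= _)%N; first by rewrite leq_mul2r max_card orbT.
  rewrite card_upair bin2 muln2.
  apply: leq_trans (_ : n * n.-1 <= _)%N; last by rewrite -mulnn leq_mul2l leq_pred orbT.
  by rewrite -[leqRHS]odd_double_half leq_addl.
apply: sum_sets_le => [|F' KF'].
  by rewrite mulr_ge0 ?expR_ge0 // exprn_ge0 ?sqrtr_ge0.
rewrite /b -/(K F') KF'; rewrite /K in KF'.
have f0 : (0 : R) < #|F'|%:R by apply: lt_trans KF'; rewrite mulr_gt0.
apply: le_trans (_ : expR (tau * #|F'|%:R) * (expR (n%:R ^+ 2 * rho ^+ 4 / 4) *
   Num.sqrt 2 ^+ n) * expR (- (#|F'|%:R * ln #|F'|%:R - #|F'|%:R)) <= _).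
  apply: ler_wpM2l; first by rewrite !mulr_ge0 ?expR_ge0 // exprn_ge0 ?sqrtr_ge0.
  rewrite expRN lef_pV2 ?posrE ?expR_gt0 ?ltr0n ?fact_gt0 //; exact: fact_ge_expR.
have -> (A B C D : R) : A * (B * C) * D = C * (A * B * D) by ring.
apply: ler_wpM2l; first by rewrite exprn_ge0 ?sqrtr_ge0.
rewrite -!expRD ler_expR.
have L : ln delta + ln n%:R <= ln #|F'|%:R.
  by rewrite -lnM ?posrE // ler_ln ?posrE ?mulr_gt0 // ltW.
have L1 := ler_wpM2l (ltW f0) L.
have L2 := ler_wpM2l a0 (ltW KF').
by move: L1 L2; rewrite /a; lra.
Qed.

(** * Estimates of the exponents *)

(** With r = sqrt p, ln (1/p) = - 2 ln r >= 2 (1 - r), so that the right side is at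
    least (1 - r)^2. *)
Lemma log_gap_ge (R : realType) (p : R) : 0 < p <= 1 -> (1 - p) ^+ 2 / 4 <= ln (1 / p) - 1 + p.
Proof.
move=> /andP[p0 p1]; pose r := Num.sqrt p.
have r0 : 0 < r by rewrite sqrtr_gt0.
have pE : p = r ^+ 2 by rewrite sqr_sqrtr // ltW.
have r1 : r <= 1 by rewrite -sqrtr1 ler_wsqrtr.
have l : ln r <= r - 1.
  have E1 : 1 + (r - 1) = r by rewrite addrC subrK.
  by have := @le_ln1Dx R (r - 1); rewrite E1; apply; lra.
have -> : ln (1 / p) = - (2 * ln r).
  by rewrite div1r lnV ?posrE // pE lnXn // mulr_natl.
rewrite pE.
have h : (1 + r) ^+ 2 <= 4 by nra.
have := ler_wpM2l (sqr_ge0 (1 - r)) h.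
have -> : (1 - r ^+ 2) ^+ 2 / 4 = (1 - r) ^+ 2 * (1 + r) ^+ 2 / 4 by field.
by move: l; lra.
Qed.

Lemma ln1D_ge (R : realType) (u : R) : 0 <= u -> u * (1 - u) <= ln (1 + u).
Proof.
move=> u0; have u1 : 0 < 1 + u by lra.
have E1 : 1 + ((1 + u)^-1 - 1) = (1 + u)^-1 by rewrite addrC subrK.
have := @le_ln1Dx R ((1 + u)^-1 - 1); rewrite E1 lnV ?posrE // => H.
have {}H : - ln (1 + u) <= (1 + u)^-1 - 1.
  have : 0 < (1 + u)^-1 by rewrite invr_gt0.
  by move=> h; apply: H; lra.
have E : (1 + u)^-1 * (1 + u) = 1 by rewrite mulVf // gt_eqF.
have i0 : 0 < (1 + u)^-1 by rewrite invr_gt0.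
have : (1 + u)^-1 - 1 <= - (u * (1 - u)).
  by move: i0 E; move: (_^-1) => i i0 E; nra.
lra.
Qed.

(** Two regimes. If s^2 is at most of order p, the optimal choice u = 1/p - 1 gives
    an exponent per edge of p s^2 (ln (1/p) - 1 + p) up to small relative
    corrections, which the margin eps absorbs. Otherwise p s^2 is at least of
    order p^2, far above (ln n)/n, and a small constant u suffices, since p is
    bounded away from 1. *)
Lemma ml_exponent_gap (R : realType) (n : nat) (p s c eps eta : R) :
  0 < p <= c -> c < 1 -> 0 < s <= 1 -> 0 < eps <= 1 ->
  0 < eta <= (1 - c) / 8 -> eta * (1 + 4 / (1 - c) ^+ 2) <= eps / 16 ->
  0 <= ln n%:R :> R ->
  (1 - eps / 16) * n%:R <= n.-1%:R :> R ->
  4 * ln n%:R <= n.-1%:R * (eps / 32 * p ^+ 2 * ((1 - c) ^+ 2 / 16)) ->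
  (2 + eps) * ln n%:R / (ln (1 / p) - 1 + p) <= n%:R * p * s ^+ 2 ->
  exists2 u : R, 0 <= u & (1 + eps / 8) * ln n%:R <= n.-1%:R / 2 *
    ((1 - eta) * (p * s ^+ 2) * ln (1 + u) - (u * (p * s) ^+ 2 + u ^+ 2 * (p * s ^+ 2) ^+ 2 / 2)).
Proof.
move=> /andP[p0 pc] c1 /andP[s0 s1] /andP[e0 e1] /andP[eta0 eta1] heta.
set l := ln n%:R; set N := n.-1%:R => l0 hN hB hthr.
have p1 : p <= 1 by lra.
set lam := _ + p in hthr.
have lamE : ln (1 / p) = lam + 1 - p by rewrite /lam; ring.
have lam1 : (1 - c) ^+ 2 / 4 <= lam.
  apply: le_trans (log_gap_ge (p := p) _); last by rewrite p0.
  by rewrite ler_pM2r ?invr_gt0 // lerXn2r // ?nnegrE; lra.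
have lam2 : (1 - p) ^+ 2 / 4 <= lam by apply: log_gap_ge; rewrite p0.
have c2 : 0 < (1 - c) ^+ 2 by rewrite exprn_gt0 // subr_gt0.
have lam0 : 0 < lam by apply: lt_le_trans lam1; rewrite divr_gt0.
have N0 : 0 <= N by rewrite ler0n.
have n0 : 0 <= n%:R :> R by rewrite ler0n.
set r := p * s ^+ 2.
have r0 : 0 < r by rewrite mulr_gt0 // exprn_gt0.
have s21 : s ^+ 2 <= 1 by rewrite expr_le1 // ltW.
have [hA|hA] := leP (s ^+ 2) (eps / 32 * p).
  have pi1 : 1 <= 1 / p by rewrite lter_pdivlMr // mul1r.
  exists (1 / p - 1); first by rewrite subr_ge0.
  have -> : 1 + (1 / p - 1) = 1 / p by rewrite addrC subrK.
  rewrite lamE.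
  have -> : (1 / p - 1) * (p * s) ^+ 2 = r * (1 - p) by rewrite /r; field; lra.
  have -> : (1 / p - 1) ^+ 2 * r ^+ 2 / 2 = r * ((1 - p) ^+ 2 * (s ^+ 2 / p) / 2).
    by rewrite /r; field; lra.
  have B1 : (1 - p) ^+ 2 * (s ^+ 2 / p) / 2 <= eps / 16 * lam.
    have : s ^+ 2 / p <= eps / 32 by rewrite ler_pdivrMr.
    move=> h; have := ler_wpM2l (sqr_ge0 (1 - p)) h.
    have h32 : 0 <= eps / 8 by lra.
    by have := ler_wpM2l h32 lam2; lra.
  have B2 : eta * (lam + 1) <= eps / 16 * lam.
    apply: le_trans (ler_wpM2r (ltW lam0) heta).
    have : 1 <= 4 / (1 - c) ^+ 2 * lam.
      apply: le_trans (_ : 4 / (1 - c) ^+ 2 * ((1 - c) ^+ 2 / 4) <= _).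
        by rewrite le_eqVlt; apply/orP; left; apply/eqP; field; lra.
      by rewrite ler_pM2l // divr_gt0.
    move=> h; rewrite -mulrA ler_pM2l //; lra.
  have G1 : r * (lam * (1 - eps / 8)) <=
     (1 - eta) * r * (lam + 1 - p) - (r * (1 - p) + r * ((1 - p) ^+ 2 * (s ^+ 2 / p) / 2)).
    have -> : (1 - eta) * r * (lam + 1 - p) - (r * (1 - p) + r * ((1 - p) ^+ 2 * (s ^+ 2 / p) / 2))
      = r * (lam - eta * (lam + 1 - p) - (1 - p) ^+ 2 * (s ^+ 2 / p) / 2) by ring.
    rewrite ler_pM2l //.
    have : 0 <= eta * p by rewrite mulr_ge0 // ltW.
    by move: B1 B2; lra.
  apply: le_trans (ler_wpM2l _ G1); last by rewrite divr_ge0.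
  have hthr' : (2 + eps) * l <= n%:R * r * lam.
    by move: hthr; rewrite ler_pdivrMr // /r !mulrA.
  have q0 : 0 <= r * lam / 2 * (1 - eps / 8).
    by rewrite !mulr_ge0 ?ltW //; lra.
  have H1 := ler_wpM2r q0 hN.
  have H2 : (1 - eps / 16) * (1 - eps / 8) / 2 * ((2 + eps) * l) <=
            (1 - eps / 16) * (1 - eps / 8) / 2 * (n%:R * r * lam).
    by apply: ler_wpM2l => //; rewrite !mulr_ge0 //; lra.
  have H3 : (1 + eps / 8) * l <= (1 - eps / 16) * (1 - eps / 8) / 2 * ((2 + eps) * l).
    rewrite mulrA; apply: ler_wpM2r => //.
    have e2 : eps ^+ 2 <= eps by rewrite expr2 ler_piMl // ltW.
    have e3 : 0 <= eps ^+ 3 by rewrite exprn_ge0 // ltW.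
    by move: e0 e2 e3; clear; lra.
  by move: H1 H2 H3; lra.
set u := (1 - c) / 8; exists u; first by rewrite /u; lra.
have u0 : 0 < u by rewrite /u; lra.
have lnu : u * (1 - u) <= ln (1 + u) by apply: ln1D_ge; exact: ltW.
have G1 : r * (u * ((1 - c) / 2)) <=
   (1 - eta) * r * ln (1 + u) - (u * (p * s) ^+ 2 + u ^+ 2 * r ^+ 2 / 2).
  have -> : (p * s) ^+ 2 = r * p by rewrite /r; ring.
  have rr : r ^+ 2 <= r.
    by rewrite expr2 ler_piMr ?(ltW r0) // /r; apply: mulr_ile1; rewrite ?sqr_ge0 // ltW.
  have L1 : (1 - eta) * r * (u * (1 - u)) <= (1 - eta) * r * ln (1 + u).
    apply: ler_wpM2l => //; rewrite mulr_ge0 ?(ltW r0) //; lra.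
  have L2 : u ^+ 2 * r ^+ 2 <= u ^+ 2 * r by apply: ler_wpM2l; rewrite // sqr_ge0.
  have L3 : r * (u * ((1 - c) / 2)) <= r * (u * ((1 - eta) * (1 - u) - p - u / 2)).
    rewrite ler_pM2l // ler_pM2l //.
    have : (1 - u) * (1 - u) <= (1 - eta) * (1 - u).
      by apply: ler_wpM2r; rewrite /u; lra.
    have uE : u = (1 - c) / 8 by [].
    by have := sqr_ge0 u; move: uE pc c1; clear; lra.
  by move: L1 L2 L3; lra.
apply: le_trans (ler_wpM2l _ G1); last by rewrite divr_ge0.
have H1 : eps / 32 * p ^+ 2 * ((1 - c) ^+ 2 / 16) <= r * (u * ((1 - c) / 2)).
  have -> : r * (u * ((1 - c) / 2)) = p * s ^+ 2 * ((1 - c) ^+ 2 / 16).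
    by rewrite /r /u; field.
  apply: ler_wpM2r; first lra.
  have -> : eps / 32 * p ^+ 2 = p * (eps / 32 * p) by ring.
  by rewrite ler_pM2l // ltW.
have := ler_wpM2l N0 H1.
have : (1 + eps / 8) * l <= 2 * l by apply: ler_wpM2r => //; lra.
by move: hB; lra.
Qed.

(** An upper bound for the logarithm of the likelihood ratio that stays finite for
    s = 1, where that ratio can vanish. *)
Definition log_lr_bound (R : realType) (p s : R) (a b : bool) : R :=
  if a && b then ln (1 / p) else
  if a || b then - edge_corr p s else edge_corr p s * (p * s) / (1 - p * s).

Lemma edge_lr_le (R : realType) (p s : R) (a b : bool) :
  0 < p < 1 -> 0 < s <= 1 -> edge_lr p s a b <= expR (log_lr_bound p s a b).
Proof.
move=> /andP[p0 p1] /andP[s0 s1].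
have q0 : 0 < p * s by rewrite mulr_gt0.
have q1 : p * s < 1 by apply: le_lt_trans p1; rewrite ler_piMr // ltW.
have h1 : 1 - p * s != 0 by rewrite subr_eq0 eq_sym lt_eqF.
have h2 : s != 0 by rewrite gt_eqF.
have h3 : p != 0 by rewrite gt_eqF.
have mixed : p * s * (1 - s) / (p * s * (1 - p * s)) = 1 + - edge_corr p s.
  by rewrite /edge_corr; field; rewrite ?h1 ?h2 ?h3.
case: a; case: b; rewrite /edge_lr /log_lr_bound /edge_marginal /=.
- rewrite lnK ?posrE ?divr_gt0 // le_eqVlt; apply/orP; left; apply/eqP.
  by field; rewrite ?h2 ?h3.
- by rewrite mixed; exact: expR_ge1Dx.
- by rewrite [X in _ / X]mulrC mixed; exact: expR_ge1Dx.
- apply: le_trans (expR_ge1Dx _); rewrite le_eqVlt; apply/orP; left; apply/eqP.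
  by rewrite /edge_corr; field; rewrite ?h1.
Qed.

Lemma expR_le_quadratic (R : realType) (t : R) : t <= 2^-1 -> expR t <= 1 + t + 2 * t ^+ 2.
Proof.
move=> t1; have t2 : 0 < 1 - t by lra.
have H : 1 - t <= expR (- t) by apply: le_trans (expR_ge1Dx _).
apply: le_trans (_ : (1 - t)^-1 <= _).
  by rewrite -[t in leLHS]opprK expRN lef_pV2 ?posrE ?expR_gt0.
rewrite -[leLHS]mul1r ler_pdivrMr //.
have : 0 <= t ^+ 2 * (1 - 2 * t) by rewrite mulr_ge0 ?sqr_ge0 //; lra.
by lra.
Qed.

(** For small x the log-moment is nearly x times the mean of the log-likelihood
    ratio, which is p s^2 (ln (1/p) - 1 + p) up to terms of relative order s. The
    entry ln (1/p) is unbounded, which is why x ln (1/p) has to be small. *)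
Lemma mean_expR_log_lr (R : realType) (p s c eta x kappa : R) :
  0 < p <= c -> c < 1 -> 0 < s <= 1 -> 0 < eta <= 2^-1 ->
  s * (6 + 2 / (1 - c)) <= kappa -> s / (1 - c) <= 2^-1 ->
  0 <= x <= 2^-1 -> x * ln (1 / p) <= eta ->
  \sum_a \sum_b edge_law p s a b * expR (x * log_lr_bound p s a b) <=
  expR (x * (p * s ^+ 2 * (ln (1 / p) - 1 + p + 2 * eta * ln (1 / p) + kappa))).
Proof.
move=> /andP[p0 pc] c1 /andP[s0 s1] /andP[e0 e1] hk hs2 /andP[x0 x1] hx.
set L := ln (1 / p) in hx *.
have p1 : p < 1 by apply: le_lt_trans c1.
have L0 : 0 <= L by rewrite ln_ge0 // lter_pdivlMr // mul1r ltW.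
set q := p * s; set rho := edge_corr p s.
have q0 : 0 < q by rewrite mulr_gt0.
have qp : q <= p by rewrite ler_piMr // ltW.
have q1 : 0 < 1 - q by move: qp p1; clear; lra.
have rhoE : rho * (1 - q) = s * (1 - p).
  by rewrite /rho /edge_corr -/q divfK ?gt_eqF // /q; ring.
have rho0 : 0 <= rho by apply: edge_corr_ge0; apply/andP; split.
have rho_le : rho <= s.
  have h : s * (1 - p) <= s * (1 - q) by apply: ler_wpM2l; [exact: ltW|move: qp; clear; lra].
  by move: h; rewrite -rhoE ler_pM2r.
have rho_ge : s * (1 - p) <= rho by rewrite -rhoE ler_piMr //; move: q0; clear; lra.
set b0 := rho * q / (1 - q).
have b00 : 0 <= b0 by apply: divr_ge0; [apply: mulr_ge0 => //; exact: ltW|exact: ltW].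
have b0E : b0 * (1 - q) = rho * q by rewrite divfK // gt_eqF.
have b0s : b0 <= s / (1 - c).
  have c0 : 0 < 1 - c by move: c1; clear; lra.
  rewrite ler_pdivlMr //; apply: le_trans (_ : b0 * (1 - q) <= _).
    by apply: ler_wpM2l => //; move: qp pc; clear; lra.
  rewrite b0E; apply: le_trans rho_le; rewrite ler_piMr //.
  by move: qp p1; clear; lra.
have xr : x * rho <= rho by rewrite ler_piMl //; move: x1; clear; lra.
have xb : x * b0 <= b0 by rewrite ler_piMl //; move: x1; clear; lra.
have xr0 : 0 <= x * rho by rewrite mulr_ge0.
have xb0 : 0 <= x * b0 by rewrite mulr_ge0.
have xL0 : 0 <= x * L by rewrite mulr_ge0.
apply: le_trans (expR_ge1Dx _).
have E1 : expR (x * L) <= 1 + x * L * (1 + 2 * eta).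
  apply: le_trans (expR_le_quadratic _) _; first exact: le_trans hx e1.
  have := ler_wpM2l xL0 hx; clear; lra.
have E2 : (1 - s) * expR (x * - rho) <= (1 - s) + x * rho * (- 1 + 3 * s).
  have h : expR (x * - rho) <= 1 - x * rho + 2 * (x * rho * s).
    apply: le_trans (expR_le_quadratic _) _; first by rewrite mulrN; move: xr0; clear; lra.
    have := ler_wpM2l xr0 (le_trans xr rho_le); clear; lra.
  have s1' : 0 <= 1 - s by move: s1; clear; lra.
  have := ler_wpM2l s1' h.
  have : 0 <= x * rho * s * s by exact: (mulr_ge0 (mulr_ge0 xr0 (ltW s0)) (ltW s0)).
  clear; lra.
have E3 : expR (x * b0) <= 1 + x * b0 * (1 + 2 * b0).
  apply: le_trans (expR_le_quadratic _) _.
    by apply: le_trans xb _; apply: le_trans b0s _.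
  have := ler_wpM2l xb0 xb; clear; lra.
have -> : \sum_a \sum_b edge_law p s a b * expR (x * log_lr_bound p s a b) =
    q * s * expR (x * L) + 2 * q * ((1 - s) * expR (x * - rho)) +
    (1 - 2 * q + q * s) * expR (x * b0).
  by rewrite !big_bool /log_lr_bound /edge_law /= -/q -/rho -/b0 -/L; ring.
have qs0 : 0 <= q * s by rewrite mulr_ge0 // ltW.
have T1 := ler_wpM2l qs0 E1.
have q20 : 0 <= 2 * q by move: q0; clear; lra.
have T2 := ler_wpM2l q20 E2.
have w0 : 0 <= 1 - 2 * q + q * s.
  have -> : 1 - 2 * q + q * s = (1 - p) + p * (1 - s) ^+ 2 by rewrite /q; ring.
  by rewrite addr_ge0 ?mulr_ge0 ?sqr_ge0 ?subr_ge0 // ltW.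
have T3 := ler_wpM2l w0 E3.
have w1 : 1 - 2 * q + q * s <= 1 - q.
  have : q * s <= q by rewrite ler_piMr // ltW.
  by clear; lra.
have y0 : 0 <= x * b0 * (1 + 2 * b0) by rewrite mulr_ge0 //; move: b00; clear; lra.
have T4 := ler_wpM2r y0 w1.
have T5 : (1 - q) * (x * b0 * (1 + 2 * b0)) = x * q * rho * (1 + 2 * b0).
  have -> : (1 - q) * (x * b0 * (1 + 2 * b0)) = x * (1 + 2 * b0) * (b0 * (1 - q)) by ring.
  by rewrite b0E; ring.
have xq0 : 0 <= x * q by rewrite mulr_ge0 // ltW.
have S1 : rho * (- 1 + 6 * s + 2 * b0) <= s * (- (1 - p) + kappa).
  have k0 : 0 <= 6 * s + 2 * b0 by move: s0 b00; clear; lra.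
  have A1 := ler_wpM2r k0 rho_le.
  have A2 : 6 * s + 2 * b0 <= kappa.
    apply: le_trans hk; move: b0s; have -> : s * (6 + 2 / (1 - c)) = 6 * s + 2 * (s / (1 - c)) by ring.
    by clear; lra.
  have A3 := ler_wpM2l (ltW s0) A2.
  by move: A1 A3 rho_ge; clear; lra.
have S2 := ler_wpM2l xq0 S1.
have -> : x * (p * s ^+ 2 * (L - 1 + p + 2 * eta * L + kappa)) =
   x * q * (s * (- (1 - p) + kappa)) + q * s * (x * L * (1 + 2 * eta)) by rewrite /q; ring.
by move: T1 T2 T3 T4 T5 S2; clear; lra.
Qed.

(** * Asymptotics *)

Local Open Scope classical_set_scope.
Local Open Scope ring_scope.

Lemma edge_corr_le (R : realType) (p s : R) : 0 < p < 1 -> 0 < s <= 1 -> edge_corr p s <= s.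
Proof.
move=> /andP[p0 p1] /andP[s0 s1].
have ps : p * s <= p by rewrite ler_piMr // ltW.
rewrite /edge_corr ler_pdivrMr; last by move: ps p1; clear; lra.
have : s * (p * s) <= s * p by apply: ler_wpM2l => //; exact: ltW.
by clear; lra.
Qed.

Lemma near_ln_ge (R : realType) (M : R) : \forall n \near \oo, M <= ln (n%:R : R).
Proof.
near=> n; have h : expR M <= n%:R by near: n; exact: nbhs_infty_ger.
by rewrite -[leLHS]expRK ler_ln ?posrE ?expR_gt0 // (lt_le_trans (expR_gt0 M)).
Unshelve. all: by end_near. Qed.

Lemma near_ln_le_expR (R : realType) (M a : R) : 0 < a ->
  \forall n \near \oo, M * ln (n%:R : R) <= expR (a * ln (n%:R : R)).
Proof.
move=> a0; near=> n.
have l0 : 0 <= ln n%:R :> R by near: n; exact: near_ln_ge.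
have lM : 4 * M / a ^+ 2 <= ln n%:R by near: n; exact: near_ln_ge.
move: l0 lM; set l := ln n%:R => l0 lM.
have h : (a / 2 * l) ^+ 2 <= expR (a * l).
  have -> : a * l = 2 * (a / 2 * l) by field.
  have al0 : 0 <= a / 2 * l by rewrite mulr_ge0 // divr_ge0 // ltW.
  rewrite (expRM_natl 2) lerXn2r // ?nnegrE ?expR_ge0 //.
  by apply: le_trans (expR_ge1Dx _); rewrite lerDr.
apply: le_trans h.
have -> : (a / 2 * l) ^+ 2 = a ^+ 2 / 4 * l * l by field.
apply: ler_wpM2r => //.
move: lM; rewrite ler_pdivrMr ?exprn_gt0 //; lra.
Unshelve. all: by end_near. Qed.

(** This is the form in which p = n^(-o(1)) is used. *)
Lemma near_log_inv_le (R : realType) (p e : nat -> R) (theta : R) :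
  (e n @[n --> \oo] --> (0 : R)) ->
  (\forall n \near \oo, p n = n%:R `^ (- e n)) -> 0 < theta ->
  \forall n \near \oo, ln (1 / p n) <= theta * ln (n%:R : R).
Proof.
move=> /cvgrPdist_le e0 pE t0; have {}e0 := e0 _ t0; near=> n.
have en : `|0 - e n| <= theta by near: n.
have l0 : 0 <= ln n%:R :> R by near: n; exact: near_ln_ge.
have n0 : (0 : R) < n%:R by near: n; exact: nbhs_infty_gtr.
have -> : p n = n%:R `^ (- e n) by near: n.
rewrite div1r lnV ?posrE ?powR_gt0 // ln_powR mulNr opprK.
apply: ler_wpM2r => //; apply: le_trans (ler_norm _) _.
by rewrite -[e n]subr0 distrC.
Unshelve. all: by end_near. Qed.

Lemma exp2_le (R : realType) (n : nat) : (2 : R) ^+ n <= expR n%:R.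
Proof.
rewrite -[n%:R]mulr1 expRM_natl lerXn2r // ?nnegrE ?expR_ge0 //.
exact: (le_trans _ (expR_ge1Dx 1)).
Qed.

Lemma sqrt2_le (R : realType) (n : nat) : Num.sqrt (2 : R) ^+ n <= expR n%:R.
Proof.
apply: le_trans (exp2_le R n); rewrite lerXn2r // ?nnegrE ?sqrtr_ge0 //.
rewrite -[leRHS]ger0_norm // -sqrtr_sqr ler_wsqrtr // expr2; lra.
Qed.

Lemma cvg_to_one (R : realType) (f : nat -> R) :
  (\forall n \near \oo, 1 - 2 * expR (- n%:R) <= f n <= 1) ->
  (f n @[n --> \oo] --> (1 : R)).
Proof.
move=> hf; apply/cvgrPdist_le => t t0; near=> n.
have /andP[f1 f2] : 1 - 2 * expR (- n%:R) <= f n <= 1 by near: n.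
rewrite ger0_norm ?subr_ge0 //.
have nt : 2 / t <= n%:R by near: n; exact: nbhs_infty_ger.
have nE : n%:R <= expR (n%:R : R) by apply: le_trans (expR_ge1Dx _); rewrite lerDr.
have : 2 * expR (- n%:R) <= t.
  rewrite expRN ler_pdivrMr ?expR_gt0 //.
  have := le_trans nt nE; rewrite ler_pdivrMr //; lra.
by move: f1; clear; lra.
Unshelve. all: by end_near. Qed.

Lemma eq_er_prob (R : realType) (n : nat) (p s : R) (E E' : pred (outcome n)) :
  E =1 E' -> er_prob p s E = er_prob p s E'.
Proof. exact: eq_bigl. Qed.

Lemma er_probC (R : realType) (n : nat) (p s : R) (E : pred (outcome n)) :
  er_prob p s E = 1 - er_prob p s (predC E).
Proof. by rewrite -(er_prob_total n p s) /er_prob [in RHS](bigID E) /= addrK. Qed.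

Lemma er_prob_ge0 (R : realType) (n : nat) (p s : R) (E : pred (outcome n)) :
  0 < p <= 1 -> 0 < s <= 1 -> 0 <= er_prob p s E.
Proof. by move=> hp hs; apply: sumr_ge0 => w _; exact: er_law_ge0. Qed.

Lemma er_prob_cvg_one (R : realType) (p s : nat -> R) (E : forall n, pred (outcome n)) :
  (forall n, 0 < p n <= 1) -> (forall n, 0 < s n <= 1) ->
  (\forall n \near \oo, er_prob (p n) (s n) (predC (E n)) <= 2 * expR (- n%:R)) ->
  (er_prob (p n) (s n) (E n) @[n --> \oo] --> (1 : R)).
Proof.
move=> hp hs h; apply: cvg_to_one; near=> n.
rewrite er_probC lerD2l lerN2 gerBl er_prob_ge0 // andbT.
by near: n.
Unshelve. all: by end_near. Qed.

(** Since ln (1/p) = o(ln n), n p s^2 tends to infinity. So the Chernoff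
    exponents, of order n^2 p s^2 and n ln n, beat the factors e^(O(n)) that come
    from the union over sets and from the fixed edges. *)
Lemma ml_error_small (R : realType) (p s : nat -> R) (c eps delta : R) :
  (forall n, 0 < p n <= 1) -> (forall n, 0 < s n <= 1) ->
  c < 1 -> (\forall n \near \oo, p n <= c) ->
  (forall theta, 0 < theta ->
     \forall n \near \oo, ln (1 / p n) <= theta * ln (n%:R : R)) ->
  0 < eps <= 1 -> delta < 1 ->
  (\forall n \near \oo,
     (2 + eps) * ln n%:R / (ln (1 / p n) - 1 + p n) <= n%:R * p n * s n ^+ 2) ->
  forall pihat : forall n, estimator n, (forall n, is_ML (pihat n)) ->
  \forall n \near \oo, er_prob (p n) (s n) (fun w : outcome n =>
    let: (pi, A, B) := w in
    #|[set i | pihat n A B i == pi i]%SET|%:R < delta * n%:R) <= 2 * expR (- n%:R).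
Proof.
move=> hp hs c1 hpc hL heps hd hthr pihat ML.
have /andP[e0 e1] := heps.
have c10 : 0 < 1 - c by move: c1; clear; lra.
have c2 : 0 < (1 - c) ^+ 2 by rewrite exprn_gt0.
have den : 0 < 1 + 4 / (1 - c) ^+ 2 by rewrite addr_gt0 // divr_gt0.
(* The first bound on eta serves the regime of large s. The second keeps the
   loss eta ln (1/p) below a fraction eps/16 of ln (1/p) - 1 + p. *)
pose eta := Num.min ((1 - c) / 8) (eps / 16 / (1 + 4 / (1 - c) ^+ 2)).
have eta0 : 0 < eta by rewrite lt_min !divr_gt0.
have eta1 : eta <= (1 - c) / 8 by rewrite ge_min lexx.
have eta2 : eta * (1 + 4 / (1 - c) ^+ 2) <= eps / 16.
  by rewrite -ler_pdivlMr // ge_min lexx orbT.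
pose kappa := 1 - delta.
have kappa0 : 0 < kappa by rewrite subr_gt0.
(* ln (1/p) <= theta ln n makes n p s^2 at least 2/theta, which is what the tail
   of the matched edges needs against the union over 2^n sets. *)
pose theta := eta ^+ 3 * kappa / 8.
have theta0 : 0 < theta by rewrite divr_gt0 // mulr_gt0 // exprn_gt0.
pose K : R := eps / 32 * ((1 - c) ^+ 2 / 16).
have K0 : 0 < K by rewrite mulr_gt0 // divr_gt0.
near=> n.
have pc : p n <= c by near: n.
have l1 : 1 <= ln n%:R :> R by near: n; exact: near_ln_ge.
have lbig : 24 / (eps * kappa) <= ln n%:R :> R by near: n; exact: near_ln_ge.
have Lq : ln (1 / p n) <= 4^-1 * ln n%:R by near: n; apply: hL; rewrite invr_gt0.
have Lt : ln (1 / p n) <= theta * ln n%:R by near: n; exact: hL.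
have grow : 8 / K * ln n%:R <= expR (2^-1 * ln n%:R).
  by near: n; apply: near_ln_le_expR; rewrite invr_gt0.
have n2 : (2 : R) <= n%:R by near: n; exact: nbhs_infty_ger.
have n16 : 16 / eps <= n%:R by near: n; exact: nbhs_infty_ger.
have thr : (2 + eps) * ln n%:R / (ln (1 / p n) - 1 + p n) <= n%:R * p n * s n ^+ 2 by near: n.
have /andP[p0 p1] := hp n; have /andP[s0 s1] := hs n.
have n1 : (1 < n)%N by rewrite -(ltr_nat R); move: n2; clear; lra.
have nR : 0 < n%:R :> R by move: n2; clear; lra.
have l0 : 0 <= ln n%:R :> R by move: l1; clear; lra.
have predE : n.-1%:R = n%:R - 1 :> R by rewrite -subn1 natrB // ltnW.
have lnE : expR (ln n%:R) = n%:R :> R by rewrite lnK.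
move: l1 lbig Lq Lt grow thr l0 lnE; set l := ln n%:R; set L := ln (1 / p n).
move=> l1 lbig Lq Lt grow thr l0 lnE.
have pE : p n = expR (- L) by rewrite /L div1r lnV ?posrE // opprK lnK.
have lam0 : 0 < L - 1 + p n.
  apply: lt_le_trans (log_gap_ge (hp n)).
  by rewrite divr_gt0 // exprn_gt0 //; move: pc c1; clear; lra.
have [||||||||||u u0 gap] := @ml_exponent_gap R n (p n) (s n) c eps eta.
- by rewrite p0.
- by [].
- exact: hs.
- exact: heps.
- by rewrite eta0.
- by [].
- by [].
- rewrite predE; move: n16; rewrite ler_pdivrMr //; clear; lra.
- have h1 : expR (- (2^-1 * l)) <= p n ^+ 2.
    rewrite pE -(expRM_natl 2) ler_expR; move: Lq; clear; lra.
  have h2 : expR (2^-1 * l) <= n%:R * p n ^+ 2.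
    apply: le_trans (ler_wpM2l (ltW nR) h1).
    by rewrite -[X in _ <= X * _]lnE -expRD ler_expR; clear; lra.
  have h3 : 8 * l <= K * (n%:R * p n ^+ 2).
    have := le_trans grow h2; rewrite mulrAC ler_pdivrMr // mulrC => h.
    by rewrite [leRHS]mulrC; move: h; rewrite [_ * K]mulrC [leRHS]mulrC.
  have p20 : 0 <= K * p n ^+ 2 by rewrite mulr_ge0 ?sqr_ge0 // ltW.
  have n12 : n%:R / 2 <= n.-1%:R :> R by rewrite predE; move: n2; clear; lra.
  have := ler_wpM2r p20 n12; move: h3; rewrite /K -/l; clear; lra.
- exact: thr.
have etab : 0 < eta <= 1 by rewrite eta0; move: eta1 p0 pc; clear; lra.
have eps8 : 0 <= eps / 8 by rewrite divr_ge0 // ltW.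
apply: le_trans (ml_error_bound n1 (hp n) (hs n) u0 etab eps8 (ltW hd) gap (ML n)) _.
rewrite -/kappa -/l.
have A1 : 2 * n%:R <= eta ^+ 3 / 4 * (p n * s n ^+ 2) * (kappa * n%:R * n.-1%:R).
  have lamL : L - 1 + p n <= theta * l by move: Lt p1; clear; lra.
  have r1 : 2 / theta <= n%:R * (p n * s n ^+ 2).
    rewrite mulrA; apply: le_trans thr.
    rewrite ler_pdivrMr // mulrAC ler_pdivlMr //.
    apply: le_trans (_ : 2 * (theta * l) <= _); first by apply: ler_wpM2l.
    have : 0 <= eps * l * theta by apply: mulr_ge0 (ltW theta0); apply: mulr_ge0 => //; exact: ltW.
    clear; lra.
  have n12 : n%:R / 2 <= n.-1%:R :> R by rewrite predE; move: n2; clear; lra.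
  have r0 : 0 <= p n * s n ^+ 2 by rewrite mulr_ge0 ?sqr_ge0 // ltW.
  have q0 : 0 <= eta ^+ 3 / 4 * (p n * s n ^+ 2) * (kappa * n%:R).
    apply: mulr_ge0; last by apply: mulr_ge0; exact: ltW.
    by apply: mulr_ge0 => //; apply: divr_ge0 => //; apply: exprn_ge0; exact: ltW.
  have := ler_wpM2l q0 n12.
  have q1 : 0 <= eta ^+ 3 / 8 * kappa * n%:R.
    apply: mulr_ge0 (ltW nR); apply: mulr_ge0 (ltW kappa0).
    by apply: divr_ge0 => //; apply: exprn_ge0; exact: ltW.
  have := ler_wpM2l q1 r1.
  have -> : eta ^+ 3 / 8 * kappa * n%:R * (2 / theta) = 2 * n%:R.
    by rewrite /theta; field; rewrite ?gt_eqF.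
  clear; lra.
have A2 : 3 * n%:R <= eps / 8 * kappa * n%:R * l.
  have q0 : 0 <= n%:R / 8 :> R by rewrite divr_ge0.
  move: lbig; rewrite ler_pdivrMr ?mulr_gt0 // => h.
  have := ler_wpM2l q0 h; clear; lra.
have B1 : 2 ^+ n * expR (- (eta ^+ 3 / 4 * (p n * s n ^+ 2) * (kappa * n%:R * n.-1%:R))) <=
    expR (- n%:R).
  apply: le_trans (ler_wpM2r (expR_ge0 _) (exp2_le R n)) _.
  rewrite -expRD ler_expR; move: A1; clear; lra.
have B2 : 2 ^+ n * (Num.sqrt 2 ^+ n * expR (- (eps / 8 * kappa * n%:R * l))) <= expR (- n%:R).
  apply: le_trans (_ : expR n%:R * (expR n%:R * expR (- (eps / 8 * kappa * n%:R * l))) <= _).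
    apply: ler_pM; rewrite ?exprn_ge0 ?mulr_ge0 ?exprn_ge0 ?sqrtr_ge0 ?expR_ge0 ?exp2_le //.
    by apply: ler_wpM2r; [exact: expR_ge0|exact: sqrt2_le].
  rewrite -!expRD ler_expR; move: A2; clear; lra.
rewrite mulrDr; move: B1 B2; clear; lra.
Unshelve. all: by end_near. Qed.

(** The hypothesis forces n s^2 <= n^(1/2), so that the edges that sigma moves
    contribute e^(O(n)) to the second moment. The Chernoff parameter is
    x = eta / (1 + ln (1/p)): small against 1/ln (1/p), and still x ln n tends to
    infinity, which beats the 2^n sets in the union. *)
Lemma estimator_error_small (R : realType) (p s : nat -> R) (c eps delta : R) :
  (forall n, 0 < p n <= 1) -> (forall n, 0 < s n <= 1) ->
  c < 1 -> (\forall n \near \oo, p n <= c) ->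
  (forall theta, 0 < theta ->
     \forall n \near \oo, ln (1 / p n) <= theta * ln (n%:R : R)) ->
  0 < eps <= 1 -> 0 < delta ->
  (\forall n \near \oo,
     n%:R * p n * s n ^+ 2 <= (2 - eps) * ln n%:R / (ln (1 / p n) - 1 + p n)) ->
  forall pihat : forall n, estimator n,
  \forall n \near \oo, er_prob (p n) (s n) (fun w : outcome n =>
    let: (pi, A, B) := w in
    delta * n%:R < #|[set i | pihat n A B i == pi i]%SET|%:R) <= 2 * expR (- n%:R).
Proof.
move=> hp hs c1 hpc hL /andP[e0 e1] d0 hthr pihat.
have c10 : 0 < 1 - c by move: c1; clear; lra.
have c2 : 0 < (1 - c) ^+ 2 by rewrite exprn_gt0.
have den : 0 < 1 + 4 / (1 - c) ^+ 2 by rewrite addr_gt0 // divr_gt0.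
pose eta := Num.min (2^-1) (eps / 32 / (1 + 4 / (1 - c) ^+ 2)).
have eta0 : 0 < eta by rewrite lt_min invr_gt0 ltr0n; apply: divr_gt0 => //; apply: divr_gt0.
have eta1 : eta <= 2^-1 by rewrite ge_min lexx.
have eta2 : eta * (1 + 4 / (1 - c) ^+ 2) <= eps / 32.
  by rewrite -ler_pdivlMr // ge_min lexx orbT.
pose kappa := (1 - c) ^+ 2 / 4 * (eps / 16).
have kappa0 : 0 < kappa by rewrite mulr_gt0 // divr_gt0.
have den2 : 0 < 6 + 2 / (1 - c) by rewrite addr_gt0 // divr_gt0.
(* The corrections of relative order s in the Chernoff exponent stay below kappa
   as long as s <= sigma. *)
pose sigma := kappa / (6 + 2 / (1 - c)).
have sigma0 : 0 < sigma by rewrite divr_gt0.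
(* 1 + ln (1/p) <= 2 theta ln n makes the Chernoff exponent at least 2 n. *)
pose theta := eta * eps * delta / 16.
have theta0 : 0 < theta by rewrite divr_gt0 // !mulr_gt0.
near=> n.
have pc : p n <= c by near: n.
have l1 : 1 <= ln n%:R :> R by near: n; exact: near_ln_ge.
have lbig1 : 1 / theta <= ln n%:R :> R by near: n; exact: near_ln_ge.
have lbig2 : (7 / delta + 1 - ln delta) * (8 / eps) <= ln n%:R by near: n; exact: near_ln_ge.
have Lq : ln (1 / p n) <= 4^-1 * ln n%:R by near: n; apply: hL; rewrite invr_gt0.
have Lt : ln (1 / p n) <= theta * ln n%:R by near: n; exact: hL.
have grow1 : 8 / (1 - c) ^+ 2 * ln n%:R <= expR (4^-1 * ln n%:R).
  by near: n; apply: near_ln_le_expR; rewrite invr_gt0.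
have grow2 : 1 / sigma ^+ 2 * ln n%:R <= expR (2^-1 * ln n%:R).
  by near: n; apply: near_ln_le_expR; rewrite invr_gt0.
have n2 : (2 : R) <= n%:R by near: n; exact: nbhs_infty_ger.
have thr : n%:R * p n * s n ^+ 2 <= (2 - eps) * ln n%:R / (ln (1 / p n) - 1 + p n) by near: n.
have /andP[p0 p1] := hp n; have /andP[s0 s1] := hs n.
have nR : 0 < n%:R :> R by move: n2; clear; lra.
have n0 : (0 < n)%N by rewrite -(ltr_nat R).
have l0 : 0 <= ln n%:R :> R by move: l1; clear; lra.
have lnE : expR (ln n%:R) = n%:R :> R by rewrite lnK.
move: l1 lbig1 lbig2 Lq Lt grow1 grow2 thr l0 lnE; set l := ln n%:R; set L := ln (1 / p n).
move=> l1 lbig1 lbig2 Lq Lt grow1 grow2 thr l0 lnE.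
have pE : p n = expR (- L) by rewrite /L div1r lnV ?posrE // opprK lnK.
have p1' : p n < 1 by apply: le_lt_trans c1.
have L0 : 0 <= L by rewrite ln_ge0 // lter_pdivlMr // mul1r.
set lam := L - 1 + p n in thr.
have lam1 : (1 - c) ^+ 2 / 4 <= lam.
  apply: le_trans (log_gap_ge (hp n)).
  by rewrite ler_pM2r ?invr_gt0 // lerXn2r // ?nnegrE; move: pc c1; clear; lra.
have lam0 : 0 < lam by apply: lt_le_trans lam1; rewrite divr_gt0.
set r := p n * s n ^+ 2.
have r0 : 0 <= r by rewrite mulr_ge0 ?sqr_ge0 // ltW.
have thr' : n%:R * r * lam <= (2 - eps) * l.
  by move: thr; rewrite ler_pdivlMr // /r mulrA.
have ns2 : n%:R * s n ^+ 2 <= expR (2^-1 * l).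
  have h1 : n%:R * r * ((1 - c) ^+ 2 / 4) <= 2 * l.
    have nr0 : 0 <= n%:R * r by rewrite mulr_ge0 // ltW.
    have := ler_wpM2l nr0 lam1.
    have : 0 <= eps * l by rewrite mulr_ge0 // ltW.
    move: thr'; clear; lra.
  have h2 : n%:R * r <= expR (4^-1 * l).
    apply: le_trans grow1.
    have -> : 8 / (1 - c) ^+ 2 * l = 2 * l / ((1 - c) ^+ 2 / 4) by field; rewrite gt_eqF.
    by rewrite ler_pdivlMr // divr_gt0.
  have h3 : n%:R * s n ^+ 2 = n%:R * r * expR L.
    by rewrite -[L]opprK expRN -pE /r; field; rewrite gt_eqF.
  rewrite h3; apply: le_trans (ler_wpM2r (expR_ge0 _) h2) _.
  by rewrite -expRD ler_expR; move: Lq; clear; lra.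
have s_small : s n <= sigma.
  rewrite -ler_sqr ?nnegrE ?(ltW s0) ?(ltW sigma0) //.
  have h1 : expR (2^-1 * l) * sigma ^+ 2 >= 1.
    have sg0 : 0 < sigma ^+ 2 by rewrite exprn_gt0.
    move: grow2; rewrite mulrAC ler_pdivrMr // mul1r; exact: le_trans.
  have h2 : n%:R = expR (2^-1 * l) * expR (2^-1 * l) :> R.
    by rewrite -expRD -lnE; congr expR; field.
  move: ns2; rewrite h2 -mulrA -[leRHS]mulr1 ler_pM2l ?expR_gt0 // => h3.
  by have := le_trans h3 h1; rewrite (ler_pM2l (expR_gt0 _)).
have kappa1 : s n * (6 + 2 / (1 - c)) <= kappa.
  by rewrite -ler_pdivlMr.
have s_half : s n / (1 - c) <= 2^-1.
  have k1 : kappa <= 1.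
    have c3 : (1 - c) ^+ 2 <= 1.
      by rewrite expr_le1 //; move: c10 p0 pc; clear; lra.
    apply: mulr_ile1; move: c2 c3 e0 e1; clear; lra.
  move: kappa1; have -> : s n * (6 + 2 / (1 - c)) = 6 * s n + 2 * (s n / (1 - c)) by ring.
  by move: k1 s0; clear; lra.
pose x := eta / (1 + L).
have L1 : 0 < 1 + L by move: L0; clear; lra.
have xE : x * (1 + L) = eta by rewrite divfK // gt_eqF.
have x0 : 0 <= x by rewrite divr_ge0 // ltW.
have xL0 : 0 <= x * L by rewrite mulr_ge0.
have hp' : 0 < p n < 1 by rewrite p0.
have hx : x * L <= eta by move: xE x0; clear; lra.
have hx2 : 0 <= x <= 2^-1 by rewrite x0; move: xE xL0 eta1; clear; lra.
pose y := x * (r * lam * (1 + eps / 8)).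
have hy : \sum_a \sum_b edge_law (p n) (s n) a b *
    expR (x * log_lr_bound (p n) (s n) a b) <= expR y.
  have hpn : 0 < p n <= c by rewrite p0.
  have hetan : 0 < eta <= 2^-1 by rewrite eta0.
  apply: le_trans (mean_expR_log_lr hpn c1 (hs n) hetan kappa1 s_half hx2 hx) _.
  rewrite ler_expR /y -/r -/L -/lam; apply: ler_wpM2l => //.
  rewrite -[leRHS]mulrA; apply: ler_wpM2l => //.
  have B1 : eta * (lam + 1) <= eps / 32 * lam.
    apply: le_trans (ler_wpM2r (ltW lam0) eta2).
    have : 1 <= 4 / (1 - c) ^+ 2 * lam.
      apply: le_trans (_ : 4 / (1 - c) ^+ 2 * ((1 - c) ^+ 2 / 4) <= _).
        by rewrite le_eqVlt; apply/orP; left; apply/eqP; field; rewrite gt_eqF.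
      by rewrite ler_pM2l // divr_gt0.
    move=> h; rewrite -mulrA ler_pM2l //; move: h; clear; lra.
  have B2 : kappa <= lam * (eps / 16) by apply: ler_wpM2r => //; rewrite divr_ge0 // ltW.
  have B3 : eta * L <= eta * (lam + 1).
    by apply: ler_wpM2l; [exact: ltW|rewrite /lam; move: p0; clear; lra].
  move: B1 B2 B3; clear; lra.
have y0 : 0 <= y.
  apply: mulr_ge0 => //; apply: mulr_ge0; first by apply: mulr_ge0 => //; exact: ltW.
  by move: e0; clear; lra.
(* The mean of the log-likelihood ratio is at most (1 - eps/2) l per vertex; tau
   lies between this and l, and gamma is the margin left below tau. *)
pose tau := (1 - eps / 8) * l; pose gamma := eps / 4 * l.
have g0 : 0 <= gamma by apply: mulr_ge0 => //; apply: divr_ge0 => //; exact: ltW.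
have gap : y * n%:R / 2 <= x * (tau - gamma).
  have -> : y * n%:R / 2 = x * (n%:R * r * lam * (1 + eps / 8) / 2) by rewrite /y; ring.
  apply: ler_wpM2l => //.
  have e8 : 0 <= (1 + eps / 8) / 2 by move: e0; clear; lra.
  have := ler_wpM2r e8 thr'.
  have : 0 <= eps ^+ 2 * l by rewrite mulr_ge0 ?sqr_ge0.
  rewrite /tau /gamma; clear; lra.
have a7 : 7 <= (l - tau + ln delta - 1) * delta.
  have h : 7 / delta + 1 - ln delta <= l * (eps / 8).
    move: lbig2; rewrite -ler_pdivlMr ?divr_gt0 //.
    by have -> : l / (8 / eps) = l * (eps / 8) by field; rewrite gt_eqF.
  rewrite -ler_pdivrMr // /tau; move: h; clear; lra.
have a0 : 0 <= l - tau + ln delta - 1.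
  by rewrite -(pmulr_lge0 _ d0); move: a7; clear; lra.
apply: le_trans (estimator_error_bound (pihat n) n0 hp' (hs n) d0
  (fun a b => edge_lr_le a b hp' (hs n)) x0 y0 g0 hy gap a0) _.
have B1 : 2 ^+ n * expR (- (x * gamma * (delta * n%:R))) <= expR (- n%:R).
  apply: le_trans (ler_wpM2r (expR_ge0 _) (exp2_le R n)) _; rewrite -expRD ler_expR.
  have h : 2 <= x * gamma * delta.
    have h1 : 1 + L <= 2 * theta * l.
      by move: lbig1 Lt; rewrite ler_pdivrMr // mulrC; clear; lra.
    have -> : x * gamma * delta = 4 * theta * l / (1 + L).
      by rewrite /x /gamma /theta; field; rewrite gt_eqF.
    by rewrite ler_pdivlMr //; move: h1; clear; lra.
  have := ler_wpM2r (ltW nR) h; clear; lra.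
have rho4 : n%:R ^+ 2 * edge_corr (p n) (s n) ^+ 4 <= n%:R.
  have rho0 : 0 <= edge_corr (p n) (s n) by exact: edge_corr_ge0.
  have rho_s : edge_corr (p n) (s n) ^+ 4 <= s n ^+ 4.
    by rewrite lerXn2r // ?nnegrE ?(ltW s0) //; exact: edge_corr_le.
  apply: le_trans (ler_wpM2l (sqr_ge0 _) rho_s) _.
  have -> : n%:R ^+ 2 * s n ^+ 4 = (n%:R * s n ^+ 2) ^+ 2 :> R by ring.
  have nE : n%:R = expR (2^-1 * l) ^+ 2 :> R.
    by rewrite -(expRM_natl 2) -lnE; congr expR; field.
  rewrite [leRHS]nE lerXn2r // nnegrE ?expR_ge0 //.
  by rewrite mulr_ge0 ?sqr_ge0.
have B2 : 2 ^+ n * Num.sqrt (2 ^+ n * (Num.sqrt 2 ^+ n *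
    expR (n%:R ^+ 2 * edge_corr (p n) (s n) ^+ 4 / 4 -
      (l - tau + ln delta - 1) * (delta * n%:R)))) <= expR (- n%:R).
  apply: le_trans (_ : expR n%:R * expR (1 * - (2 * n%:R)) <= _); last first.
    by rewrite -expRD ler_expR; clear; lra.
  apply: ler_pM; rewrite ?exprn_ge0 ?sqrtr_ge0 ?exp2_le //.
  rewrite -[Num.sqrt _]expr1; apply: sqrt_exp_le.
  apply: le_trans (_ : expR n%:R * (expR n%:R * expR (n%:R ^+ 2 * edge_corr (p n) (s n) ^+ 4 / 4 -
      (l - tau + ln delta - 1) * (delta * n%:R))) <= _).
    apply: ler_pM; rewrite ?exprn_ge0 ?mulr_ge0 ?exprn_ge0 ?sqrtr_ge0 ?expR_ge0 ?exp2_le //.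
    by apply: ler_wpM2r; [exact: expR_ge0|exact: sqrt2_le].
  rewrite -!expRD ler_expR.
  have := ler_wpM2r (ltW nR) a7; move: rho4 nR; clear; lra.
move: B1 B2; clear; lra.
Unshelve. all: by end_near. Qed.

Theorem theorem2 (R : realType) (p s : nat -> R) (eps : R)
    (hp : forall n : nat, 0 < p n <= 1)
    (hs : forall n : nat, 0 < s n <= 1)
    (hp1 : exists2 c : R, c < 1 & \forall n \near \oo, p n <= c)
    (hpo : exists2 e : nat -> R, e n @[n --> \oo] --> (0 : R) &
             \forall n \near \oo, p n = n%:R `^ (- e n))
    (heps : 0 < eps) :
  ((\forall n \near \oo,
      (2 + eps) * ln n%:R / (ln (1 / p n) - 1 + p n) <= n%:R * p n * s n ^+ 2) ->
   forall pihat_ML : forall n : nat, estimator n,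
   (forall n : nat, is_ML (pihat_ML n)) ->
   forall delta : R, delta < 1 ->
   er_prob (p n) (s n)
     (fun w : outcome n =>
        let: (pi, A, B) := w in delta <= overlap R (pihat_ML n A B) pi)
     @[n --> \oo] --> (1 : R))
  /\
  ((\forall n \near \oo,
      n%:R * p n * s n ^+ 2 <= (2 - eps) * ln n%:R / (ln (1 / p n) - 1 + p n)) ->
   forall pihat : forall n : nat, estimator n,
   forall delta : R, 0 < delta ->
   er_prob (p n) (s n)
     (fun w : outcome n =>
        let: (pi, A, B) := w in overlap R (pihat n A B) pi <= delta)
     @[n --> \oo] --> (1 : R)).
Proof.
have [c c1 hc] := hp1; have [e e0 he] := hpo.
have hL theta : 0 < theta -> \forall n \near \oo, ln (1 / p n) <= theta * ln (n%:R : R).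
  exact: near_log_inv_le e0 he.
(* Both conditions only get weaker when eps is replaced by min(eps, 1). *)
pose eps1 := Num.min eps 1.
have heps1 : 0 < eps1 <= 1 by rewrite lt_min heps ltr01 ge_min lexx orbT.
have eps1_le : eps1 <= eps by rewrite ge_min lexx.
have gap0 n : 1 <= n%:R :> R -> 0 <= ln n%:R / (ln (1 / p n) - 1 + p n).
  move=> n1; rewrite divr_ge0 ?ln_ge0 //.
  by apply: le_trans (log_gap_ge (hp n)); rewrite divr_ge0 ?sqr_ge0.
split=> [thr pihat ML delta d1|thr pihat delta d0]; apply: er_prob_cvg_one => //.
  have thr1 : \forall n \near \oo,
     (2 + eps1) * ln n%:R / (ln (1 / p n) - 1 + p n) <= n%:R * p n * s n ^+ 2.
    near=> n; apply: le_trans (_ : (2 + eps) * ln n%:R / (ln (1 / p n) - 1 + p n) <= _).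
      rewrite -!(mulrA (2 + _)); apply: ler_wpM2r; last by rewrite lerD2l.
      by apply: gap0; near: n; exact: nbhs_infty_ger.
    by near: n.
  have small := ml_error_small hp hs c1 hc hL heps1 d1 thr1 ML.
  near=> n; have n0 : 0 < n%:R :> R by near: n; exact: nbhs_infty_gtr.
  rewrite (_ : er_prob _ _ _ = er_prob (p n) (s n) (fun w : outcome n =>
    let: (pi, A, B) := w in
    #|[set i | pihat n A B i == pi i]%SET|%:R < delta * n%:R)); first by near: n.
  by apply: eq_er_prob => -[[pi A] B] /=; rewrite /overlap ler_pdivlMr // ltNge.
have thr1 : \forall n \near \oo,
   n%:R * p n * s n ^+ 2 <= (2 - eps1) * ln n%:R / (ln (1 / p n) - 1 + p n).
  near=> n; apply: le_trans (_ : (2 - eps) * ln n%:R / (ln (1 / p n) - 1 + p n) <= _).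
    by near: n.
  rewrite -!(mulrA (2 - _)); apply: ler_wpM2r; last by rewrite lerD2l lerN2.
  by apply: gap0; near: n; exact: nbhs_infty_ger.
have small := estimator_error_small hp hs c1 hc hL heps1 d0 thr1 pihat.
near=> n; have n0 : 0 < n%:R :> R by near: n; exact: nbhs_infty_gtr.
rewrite (_ : er_prob _ _ _ = er_prob (p n) (s n) (fun w : outcome n =>
  let: (pi, A, B) := w in
  delta * n%:R < #|[set i | pihat n A B i == pi i]%SET|%:R)); first by near: n.
by apply: eq_er_prob => -[[pi A] B] /=; rewrite /overlap ler_pdivrMr // ltNge.
Unshelve. all: by end_near. Qed.
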